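(* Let $M$ be a thread-register model in which every register LTS is the atomic register LTS, and for $C\in\{A,I,S\}$ let $M_C$ be the model obtained from $M$ by replacing every register LTS by its $C$-variant. Let $\mathcal B=\{\mathit{nc}_t : t\in\mathbb T\}$. Then for each $C\in\{A,I,S\}$ we have $\mathit{WCT}_C(M_C)=\mathit{WCT}_C(M)$, i.e. $M_A$ and $M$ are weak completed trace equivalent with respect to $\mathcal B$-$\smile_A$-justness, $M_I$ and $M$ with respect to $\mathcal B$-$\smile_I$-justness, and $M_S$ and $M$ with respect to $\mathcal B$-$\smile_S$-justness.
   Context: An LTS is a tuple $(S,\mathit{Act},\mathit{init},\mathit{Trans})$ with finite state set $S$, finite action set $\mathit{Act}$, initial state $\mathit{init}$ and $\mathit{Trans}\subseteq S\times\mathit{Act}\times S$; $a$ is enabled in $s$ if $(s,a,s')\in\mathit{Trans}$ for some $s'$. A path is a nonempty finite or infinite alternating sequence $s_0a_1s_1a_2\ldots$ of states and actions with $(s_i,a_{i+1},s_{i+1})\in\mathit{Trans}$ for all $i$, ending in a state if finite. The parallel composition $P_1\|\cdots\|P_k$ of LTSs $P_i=(S_i,\mathit{Act}_i,\mathit{init}_i,\mathit{Trans}_i)$ has states $S_1\times\cdots\times S_k$, actions $\bigcup_i\mathit{Act}_i$, initial state $(\mathit{init}_1,\ldots,\mathit{init}_k)$, and a transition $((s_1,\ldots,s_k),a,(s'_1,\ldots,s'_k))$ iff for every $i$: $s'_i=s_i$ if $a\notin\mathit{Act}_i$, and $(s_i,a,s'_i)\in\mathit{Trans}_i$ if $a\in\mathit{Act}_i$.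 Registers. Fix disjoint finite sets $\mathbb T$ (thread ids) and $\mathbb R$ (register ids); each $r\in\mathbb R$ has a finite domain $D_r$ and initial value $d^0_r\in D_r$. For $t\in\mathbb T$, $r\in\mathbb R$, $d\in D_r$ the register actions are the interface actions $\mathit{sr}_{t,r}$ (start read), $\mathit{fr}_{t,r}(d)$ (finish read returning $d$), $\mathit{sw}_{t,r}(d)$ (start write of $d$), $\mathit{fw}_{t,r}$ (finish write), and the register-local actions $\mathit{or}_{t,r}$, $\mathit{ow}_{t,r}$. States of a register LTS for $r$ are statuses $s$, consisting of $\mathit{stor}(s)\in D_r$, sets $\mathit{rds}(s),\mathit{wrts}(s),\mathit{pend}(s)\subseteq\mathbb T$, and for each $t$ values $\mathit{rec}(s,t)\in D_r$, $\mathit{ovrl}(s,t)\in\{\mathit{true},\mathit{false}\}$, $\mathit{posv}(s,t)\subseteq D_r$. The initial status has $\mathit{stor}=d^0_r$, $\mathit{rds}=\mathit{wrts}=\mathit{pend}=\emptyset$, $\mathit{rec}(t)=d^0_r$, $\mathit{ovrl}(t)=\mathit{false}$, $\mathit{posv}(t)=\emptyset$. Updates (unmentioned components unchanged, right-hand sides evaluated in $s$): $\mathit{usr}(s,t)$ adds $t$ to $\mathit{rds}$ and $\mathit{pend}$, sets $\mathit{ovrl}(t):=(\mathit{wrts}(s)\neq\emptyset)$ and $\mathit{posv}(t):=\{\mathit{stor}(s)\}\cup\{\mathit{rec}(s,t'):t'\in\mathit{wrts}(s)\}$; $\mathit{ufr}(s,t)$ removes $t$ from $\mathit{rds}$; $\mathit{usw}(s,t,d)$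 adds $t$ to $\mathit{wrts}$ and $\mathit{pend}$, sets $\mathit{rec}(t):=d$, $\mathit{ovrl}(t):=(\mathit{wrts}(s)\neq\emptyset)$, and for every $t'\neq t$ sets $\mathit{ovrl}(t'):=\mathit{true}$ and $\mathit{posv}(t'):=\mathit{posv}(s,t')\cup\{d\}$; $\mathit{ufw}(s,t,d)$ sets $\mathit{stor}:=d$ and removes $t$ from $\mathit{wrts}$; $\mathit{uor}(s,t)$ removes $t$ from $\mathit{pend}$ and sets $\mathit{rec}(t):=\mathit{stor}(s)$; $\mathit{uow}(s,t,d)$ sets $\mathit{stor}:=d$ and removes $t$ from $\mathit{pend}$. The atomic register LTS for $r$ has, for every status $s$, $t\in\mathbb T$, $d\in D_r$: if $t\notin\mathit{rds}(s)\cup\mathit{wrts}(s)$, transitions $s\xrightarrow{\mathit{sr}_{t,r}}\mathit{usr}(s,t)$ and $s\xrightarrow{\mathit{sw}_{t,r}(d)}\mathit{usw}(s,t,d)$; if $t\in\mathit{rds}(s)\cap\mathit{pend}(s)$, $s\xrightarrow{\mathit{or}_{t,r}}\mathit{uor}(s,t)$; if $t\in\mathit{wrts}(s)\cap\mathit{pend}(s)$, $s\xrightarrow{\mathit{ow}_{t,r}}\mathit{uow}(s,t,\mathit{rec}(s,t))$; if $t\in\mathit{rds}(s)\setminus\mathit{pend}(s)$, $s\xrightarrow{\mathit{fr}_{t,r}(\mathit{rec}(s,t))}\mathit{ufr}(s,t)$; if $t\in\mathit{wrts}(s)\setminus\mathit{pend}(s)$, $s\xrightarrow{\mathit{fw}_{t,r}}\mathit{ufw}(s,t,\mathit{stor}(s))$.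 Its initial state is the initial status. Variants: the $A$-variant is identical except that both start transitions require $\mathit{rds}(s)\cup\mathit{wrts}(s)=\emptyset$; the $I$-variant: $\mathit{sr}_{t,r}$ requires $t\notin\mathit{rds}(s)$ and $\mathit{wrts}(s)=\emptyset$, $\mathit{sw}_{t,r}(d)$ requires $\mathit{rds}(s)\cup\mathit{wrts}(s)=\emptyset$; the $S$-variant: $\mathit{sr}_{t,r}$ requires $t\notin\mathit{rds}(s)$ and $\mathit{wrts}(s)=\emptyset$, $\mathit{sw}_{t,r}(d)$ requires $\mathit{wrts}(s)=\emptyset$. Threads. For each $t$ a thread LTS $T_t$ with actions $\{\mathit{sr}_{t,r},\mathit{fr}_{t,r}(d),\mathit{sw}_{t,r}(d),\mathit{fw}_{t,r}:r\in\mathbb R,d\in D_r\}\cup\mathit{TLoc}_t$, the thread-local sets $\mathit{TLoc}_t$ pairwise disjoint and disjoint from register actions; on every path from the initial state of $T_t$, each $\mathit{sr}_{t,r}$-transition leads to a state where exactly the actions $\mathit{fr}_{t,r}(d)$, $d\in D_r$, are enabled, each $\mathit{sw}_{t,r}(d)$-transition leads to a state where only $\mathit{fw}_{t,r}$ is enabled, and $\mathit{fr}_{t,r}(d)$, $\mathit{fw}_{t,r}$ are enabled only in such states. Each $\mathit{TLoc}_t$ contains two distinct actions $\mathit{cs}_t$ (enter critical section) and $\mathit{nc}_t$ (leave non-critical section). A thread-register model is the parallel composition of all $T_t$ and one register LTS per $r\in\mathbb R$, with $\mathit{thr}(a)=t$ for every action indexed by $t$ (including $\mathit{TLoc}_t$)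 and $\mathit{reg}(a)=r$ for register actions indexed by $r$, $\mathit{reg}(a)=\bot$ for thread-local actions. Justness. For a relation $\smile$ on actions write $a\not\smile b$ for $\neg(a\smile b)$. A path $\pi$ is $\mathcal B$-$\smile$-just if for every suffix $\pi'$ of $\pi$ and every action $a\notin\mathcal B$ enabled in the first state of $\pi'$, some action $b$ with $a\not\smile b$ occurs in $\pi'$. Let $\mathit{sr?}(a)$ hold iff $a=\mathit{sr}_{t,r}$ for some $t,r$ and $\mathit{sw?}(a)$ iff $a=\mathit{sw}_{t,r}(d)$ for some $t,r,d$. Define $\smile_T=\{(a,b):\mathit{thr}(a)\neq\mathit{thr}(b)\}$, $\smile_S=\smile_T\setminus\{(a,b):(\mathit{sr?}(a)\lor\mathit{sw?}(a))\wedge\mathit{sw?}(b)\wedge\mathit{reg}(a)=\mathit{reg}(b)\}$, $\smile_I=\smile_S\setminus\{(a,b):\mathit{sw?}(a)\wedge\mathit{sr?}(b)\wedge\mathit{reg}(a)=\mathit{reg}(b)\}$, $\smile_A=\smile_I\setminus\{(a,b):\mathit{sr?}(a)\wedge\mathit{sr?}(b)\wedge\mathit{reg}(a)=\mathit{reg}(b)\}$. Traces. For a path $\pi$, $\ell^-(\pi)$ is the finite or infinite sequence of actions occurring on $\pi$ with all actions other than $\mathit{cs}_t,\mathit{nc}_t$ ($t\in\mathbb T$) deleted. For $C\in\{A,I,S\}$ and an LTS $P$, $\mathit{WCT}_C(P)$ is the set of all $\ell^-(\pi)$ for $\pi$ a $\mathcal B$-$\smile_C$-just path of $P$ starting in its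 initial state. *)

(* Defs.v *)
From HB Require Import structures.
From mathcomp Require Import boolp classical_sets.
(* After classical_sets, so that set0, setU, ... are those of finset. *)
From mathcomp Require Import all_boot.

Set Implicit Arguments.
Unset Strict Implicit.
Unset Printing Implicit Defensive.

Local Open Scope set_scope.

Inductive fiseq (X : Type) : Type :=
  | Fin of seq X
  | Inf of (nat -> X).

Definition fi_onth X (u : fiseq X) (n : nat) : option X :=
  match u with Fin s => onth s n | Inf f => Some (f n) end.

Definition fi_drop X (n : nat) (u : fiseq X) : fiseq X :=
  match u with Fin s => Fin (drop n s) | Inf f => Inf (fun k => f (n + k)) end.

Definition fi_map X Y (g : X -> Y) (u : fiseq X) : fiseq Y :=
  match u with Fin s => Fin (map g s) | Inf f => Inf (fun k => g (f k)) end.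

Definition fi_occurs X (x : X) (u : fiseq X) : Prop :=
  exists n, fi_onth u n = Some x.

Definition inf_often X (p : pred X) (f : nat -> X) : Prop :=
  forall m, exists n, (m <= n) && p (f n).

(* The position of the k-th (from 0) element of f satisfying p. *)
Fixpoint kth_pos X (p : pred X) (f : nat -> X) (h : inf_often p f) (k : nat) :=
  match k with
  | 0 => ex_minn (h 0)
  | k'.+1 => ex_minn (h (kth_pos h k').+1)
  end.

(* In the [right] case [xget] picks a position from which p no longer holds;
   the result does not depend on which one is picked. *)
Definition fi_filter X (p : pred X) (u : fiseq X) : fiseq X :=
  match u with
  | Fin s => Fin (filter p s)
  | Inf f =>
      match pselect (inf_often p f) with
      | left h => Inf (fun k => f (kth_pos h k))
      | right _ =>
          let N := xget 0 (fun m => forall n, m <= n -> ~~ p (f n)) in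
          Fin (filter p (mkseq f N))
      end
  end.

(* L is the universe of actions, of which [alphabet] is the action set of
   the given system. *)
Record lts (L : finType) := LTS {
  state : finType;
  alphabet : {set L};
  init : state;
  trans : state -> L -> state -> Prop;
  trans_alphabet : forall s a s', trans s a s' -> a \in alphabet
}.

Definition enabled (L : finType) (P : lts L) (s : state P) (a : L) : Prop :=
  exists s', trans s a s'.

(* The alternating sequence s0 a1 s1 a2 s2 ... is stored as its first state s0
   and the sequence of pairs (a1, s1) (a2, s2) ... *)
Record run (S L : Type) := Run { start : S; steps : fiseq (L * S) }.

Definition actions S L (pi : run S L) : fiseq L :=
  fi_map (fun x => x.1) (steps pi).

Definition state_at S L (pi : run S L) (n : nat) : option S :=
  if n is m.+1 then omap (fun x => x.2) (fi_onth (steps pi) m)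
  else Some (start pi).

Definition suffix_at S L (pi : run S L) (n : nat) : option (run S L) :=
  omap (fun s => Run s (fi_drop n (steps pi))) (state_at pi n).

Section Paths.
Variables (L : finType) (P : lts L).

Definition is_path (pi : run (state P) L) : Prop :=
  forall n s a s', state_at pi n = Some s ->
    fi_onth (steps pi) n = Some (a, s') -> trans s a s'.

Definition initial_path (pi : run (state P) L) : Prop :=
  is_path pi /\ start pi = init P.

Definition reachable (s : state P) : Prop :=
  exists2 pi, initial_path pi & exists n, state_at pi n = Some s.

Definition just (B : {set L}) (conc : rel L) (pi : run (state P) L) : Prop :=
  forall n pi', suffix_at pi n = Some pi' ->
  forall a, a \notin B -> enabled (start pi') a ->
  exists2 b, ~~ conc a b & fi_occurs b (actions pi').

Definition weak_completed_traces (B : {set L}) (conc : rel L) (vis : pred L) :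
    set (fiseq L) :=
  fun w => exists2 pi, initial_path pi /\ just B conc pi
                     & w = fi_filter vis (actions pi).

End Paths.

Section Parallel.
Variables (L I : finType) (P : I -> lts L).

Definition par_state : finType := {dffun forall i : I, state (P i)}.

Definition par_alphabet : {set L} := \bigcup_(i : I) alphabet (P i).

Definition par_init : par_state := [ffun i : I => init (P i)].

Definition par_trans (s : par_state) (a : L) (s' : par_state) : Prop :=
  a \in par_alphabet /\
  forall i, if a \in alphabet (P i) then trans (s i) a (s' i) else s' i = s i.

Lemma par_trans_alphabet s a s' : par_trans s a s' -> a \in par_alphabet.
Proof. by case. Qed.

Definition parallel : lts L := LTS par_init par_trans_alphabet.

End Parallel.

(* [cs t] enters the critical section, [nc t] leaves the non-critical one. *)
Record signature := Signature {
  tid : finType;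
  rid : finType;
  dom : rid -> finType;
  dinit : forall r, dom r;
  tloc : tid -> finType;
  cs : forall t, tloc t;
  nc : forall t, tloc t;
  cs_neq_nc : forall t, cs t != nc t
}.

(* sr, fr, sw, fw: start/finish of a read/write; or, ow: its register-local
   order action.  Thread-local actions are tagged by their thread, so that the
   sets of thread-local actions are disjoint by construction. *)
Inductive act (G : signature) : Type :=
  | Sr (t : tid G) (r : rid G)
  | Fr (t : tid G) (r : rid G) (d : dom r)
  | Sw (t : tid G) (r : rid G) (d : dom r)
  | Fw (t : tid G) (r : rid G)
  | Or (t : tid G) (r : rid G)
  | Ow (t : tid G) (r : rid G)
  | Loc (t : tid G) (l : tloc t).

Arguments Sr {G} t r.
Arguments Fr {G} t r d.
Arguments Sw {G} t r d.
Arguments Fw {G} t r.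
Arguments Or {G} t r.
Arguments Ow {G} t r.
Arguments Loc {G} t l.

Section ActFinType.
Variable G : signature.

Let code : Type :=
  ('I_4 * (tid G * rid G) + bool * (tid G * {r : rid G & dom r})
   + {t : tid G & tloc t})%type.

Definition act_code (a : act G) : code :=
  match a with
  | Sr t r => inl (inl (inord 0, (t, r)))
  | Fw t r => inl (inl (inord 1, (t, r)))
  | Or t r => inl (inl (inord 2, (t, r)))
  | Ow t r => inl (inl (inord 3, (t, r)))
  | Fr t r d => inl (inr (true, (t, Tagged (fun r => dom r) d)))
  | Sw t r d => inl (inr (false, (t, Tagged (fun r => dom r) d)))
  | Loc t l => inr (Tagged (fun t => tloc t) l)
  end.

Definition act_decode (c : code) : act G :=
  match c with
  | inl (inl (i, (t, r))) =>
      match val i with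
      | 0 => Sr t r | 1 => Fw t r | 2 => Or t r | _ => Ow t r
      end
  | inl (inr (true, (t, existT r d))) => Fr t r d
  | inl (inr (false, (t, existT r d))) => Sw t r d
  | inr (existT t l) => Loc t l
  end.

Lemma act_codeK : cancel act_code act_decode.
Proof. by case=> [t r|t r d|t r d|t r|t r|t r|t l] //=; rewrite inordK. Qed.

HB.instance Definition _ := Finite.copy (act G) (can_type act_codeK).

End ActFinType.

Section Model.
Variable G : signature.
Implicit Types (a b : act G) (t : tid G) (r : rid G).

Definition thr a : tid G :=
  match a with
  | Sr t _ | Fr t _ _ | Sw t _ _ | Fw t _ | Or t _ | Ow t _ | Loc t _ => t
  end.

Definition reg a : option (rid G) :=
  match a with
  | Sr _ r | Fr _ r _ | Sw _ r _ | Fw _ r | Or _ r | Ow _ r => Some r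
  | Loc _ _ => None
  end.

Definition is_sr a : bool := if a is Sr _ _ then true else false.
Definition is_sw a : bool := if a is Sw _ _ _ then true else false.

Definition register_local a : bool :=
  match a with Or _ _ | Ow _ _ => true | _ => false end.

Definition cs_actions : {set act G} := [set Loc t (cs t) | t in tid G].
Definition nc_actions : {set act G} := [set Loc t (nc t) | t in tid G].

Definition visible : pred (act G) := [pred a in cs_actions :|: nc_actions].

Definition concT : rel (act G) := fun a b => thr a != thr b.

Definition concS : rel (act G) := fun a b =>
  concT a b && ~~ [&& is_sr a || is_sw a, is_sw b & reg a == reg b].

Definition concI : rel (act G) := fun a b =>
  concS a b && ~~ [&& is_sw a, is_sr b & reg a == reg b].

Definition concA : rel (act G) := fun a b =>
  concI a b && ~~ [&& is_sr a, is_sr b & reg a == reg b].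

Section Register.
Variable r : rid G.

Record status := Status {
  stor : dom r;
  rds : {set tid G};
  wrts : {set tid G};
  pend : {set tid G};
  rcd : {ffun tid G -> dom r};
  ovrl : {ffun tid G -> bool};
  posv : {ffun tid G -> {set dom r}}
}.

Definition status_code (s : status) :=
  (stor s, rds s, wrts s, pend s, rcd s, ovrl s, posv s).

Definition status_decode c : status :=
  let: (x, rs, ws, ps, rc, ov, pv) := c in Status x rs ws ps rc ov pv.

Lemma status_codeK : cancel status_code status_decode.
Proof. by case. Qed.

HB.instance Definition _ := Finite.copy status (can_type status_codeK).

Definition init_status : status := {|
  stor := dinit r; rds := set0; wrts := set0; pend := set0;
  rcd := [ffun=> dinit r]; ovrl := [ffun=> false]; posv := [ffun=> set0] |}.

Implicit Types (s : status) (d : dom r).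

Definition usr s t : status := {|
  stor := stor s;
  rds := t |: rds s;
  wrts := wrts s;
  pend := t |: pend s;
  rcd := rcd s;
  ovrl := [ffun t' => if t' == t then wrts s != set0 else ovrl s t'];
  posv := [ffun t' => if t' == t
                      then stor s |: [set rcd s t'' | t'' in wrts s]
                      else posv s t'] |}.

Definition ufr s t : status := {|
  stor := stor s; rds := rds s :\ t; wrts := wrts s; pend := pend s;
  rcd := rcd s; ovrl := ovrl s; posv := posv s |}.

Definition usw s t d : status := {|
  stor := stor s;
  rds := rds s;
  wrts := t |: wrts s;
  pend := t |: pend s;
  rcd := [ffun t' => if t' == t then d else rcd s t'];
  ovrl := [ffun t' => if t' == t then wrts s != set0 else true];
  posv := [ffun t' => if t' == t then posv s t' else d |: posv s t'] |}.

Definition ufw s t d : status := {|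
  stor := d; rds := rds s; wrts := wrts s :\ t; pend := pend s;
  rcd := rcd s; ovrl := ovrl s; posv := posv s |}.

Definition uor s t : status := {|
  stor := stor s; rds := rds s; wrts := wrts s; pend := pend s :\ t;
  rcd := [ffun t' => if t' == t then stor s else rcd s t'];
  ovrl := ovrl s; posv := posv s |}.

Definition uow s t d : status := {|
  stor := d; rds := rds s; wrts := wrts s; pend := pend s :\ t;
  rcd := rcd s; ovrl := ovrl s; posv := posv s |}.

(* The register LTSs differ only in the guards [rg] and [wg] under which a
   thread may start a read, respectively a write. *)
Inductive register_trans (rg wg : status -> tid G -> bool) :
    status -> act G -> status -> Prop :=
  | step_sr s t : rg s t -> register_trans rg wg s (Sr t r) (usr s t)
  | step_sw s t d : wg s t -> register_trans rg wg s (Sw t r d) (usw s t d)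
  | step_or s t : t \in rds s :&: pend s ->
      register_trans rg wg s (Or t r) (uor s t)
  | step_ow s t : t \in wrts s :&: pend s ->
      register_trans rg wg s (Ow t r) (uow s t (rcd s t))
  | step_fr s t : t \in rds s :\: pend s ->
      register_trans rg wg s (Fr t r (rcd s t)) (ufr s t)
  | step_fw s t : t \in wrts s :\: pend s ->
      register_trans rg wg s (Fw t r) (ufw s t (stor s)).

Definition register_alphabet : {set act G} := [set a | reg a == Some r].

Lemma register_trans_alphabet rg wg s a s' :
  register_trans rg wg s a s' -> a \in register_alphabet.
Proof. by case=> *; rewrite inE /=. Qed.

Definition register_lts (rg wg : status -> tid G -> bool) : lts (act G) :=
  LTS init_status (@register_trans_alphabet rg wg).

Definition atomic_register : lts (act G) :=
  register_lts (fun s t => t \notin rds s :|: wrts s)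
               (fun s t => t \notin rds s :|: wrts s).

Definition registerA : lts (act G) :=
  register_lts (fun s _ => rds s :|: wrts s == set0)
               (fun s _ => rds s :|: wrts s == set0).

Definition registerI : lts (act G) :=
  register_lts (fun s t => (t \notin rds s) && (wrts s == set0))
               (fun s _ => rds s :|: wrts s == set0).

Definition registerS : lts (act G) :=
  register_lts (fun s t => (t \notin rds s) && (wrts s == set0))
               (fun s _ => wrts s == set0).

End Register.

Definition thread_alphabet t : {set act G} :=
  [set a | (thr a == t) && ~~ register_local a].

(* In [thread_fr] and [thread_fw], a state enabling a finish action is one to
   which some corresponding start transition leads; that transition need not
   be the last one of every path to that state. *)
Record is_thread t (P : lts (act G)) : Prop := IsThread {
  thread_actions : alphabet P = thread_alphabet t;
  thread_sr : forall r (s s' : state P),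
    reachable s -> trans s (Sr t r) s' ->
    forall a, enabled s' a <-> exists d, a = Fr t r d;
  thread_sw : forall r d (s s' : state P),
    reachable s -> trans s (Sw t r d) s' ->
    forall a, enabled s' a <-> a = Fw t r;
  thread_fr : forall r d (s' : state P),
    reachable s' -> enabled s' (Fr t r d) ->
    exists2 s : state P, reachable s & trans s (Sr t r) s';
  thread_fw : forall r (s' : state P),
    reachable s' -> enabled s' (Fw t r) ->
    exists2 s : state P, reachable s & exists d, trans s (Sw t r d) s'
}.

Definition model (T : tid G -> lts (act G)) (Rg : rid G -> lts (act G)) :
    lts (act G) :=
  parallel (fun i : tid G + rid G =>
              match i with inl t => T t | inr r => Rg r end).

Inductive criterion := CritA | CritI | CritS.

Definition conc (C : criterion) : rel (act G) :=
  match C with CritA => concA | CritI => concI | CritS => concS end.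

Definition variant_register (C : criterion) : rid G -> lts (act G) :=
  match C with CritA => registerA | CritI => registerI | CritS => registerS end.

Definition WCT (C : criterion) (P : lts (act G)) : set (fiseq (act G)) :=
  weak_completed_traces P nc_actions (conc C) visible.

End Model.

(* Main.v *)
(* A path of M_C is a path of M.  If it leaves a start action enabled in M but
   blocked in M_C, and nothing interfering happens, then by justness the blocking
   operations finish one after the other, no new ones start, and the start
   action becomes enabled in M_C.

   Conversely, in a just path of M every started operation is eventually ordered
   and finished, and meanwhile its thread does nothing else.  So each order
   action can be replaced by a complete block start-order-finish, all other
   start and finish actions being deleted.  Operations then never overlap, so
   this is a path of every M_C, with the same thread-local actions in the same
   order; an interfering start action reappears when its operation is ordered,
   which preserves justness.  The target of the finish action of a block is read
   off the future of the path, as threads may be nondeterministic. *)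
From mathcomp Require Import boolp classical_sets.
From mathcomp Require Import all_boot zify.
Require Import Defs.

Set Implicit Arguments.
Unset Strict Implicit.
Unset Printing Implicit Defensive.

(** * Stuttering sequences and runs *)

(** Serialization both inserts and deletes actions, so a run must be able to stand still: position
    [n] of the given run becomes positions [n * 3], [(n * 3).+1], [(n * 3).+2] of the serialized
    one, and idle positions are squeezed out only when traces are compared. The serialized registers
    are not rearranged original ones. They share only [stor] with them and are free between blocks,
    so any guard that admits starts in a free register is met, and one construction serves all three
    variants. Justness is needed already to define the serialized run, since the idle state after a
    block must exist. For its own justness, note that a serialized thread may lag behind the
    original one or run ahead of it. If it lags, its own block is still to come and interferes with
    whatever the thread enables. If it is ahead, its state is one that the original thread reaches
    later, and justness of the original path applies there. In the other direction, draining works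
    because each criterion makes a start interfere with the kinds of starts whose operations can
    block it in the variant. *)

Section Stuttering.
Variable X : Type.
Implicit Types (u v : fiseq X) (w : nat -> option X) (p : pred X).

Lemma fi_onth_ext u v : (forall k, fi_onth u k = fi_onth v k) -> u = v.
Proof.
case: u v => [s|f] [s'|f'] /= e.
- by congr Fin; apply: eq_from_onth.
- by have := e (size s); rewrite onth_default.
- by have := e (size s'); rewrite onth_default.
- by congr Inf; apply: funext => k; have [] := e k.
Qed.

Lemma fi_onth_drop n u k : fi_onth (fi_drop n u) k = fi_onth u (n + k).
Proof. by case: u => [s|f] //=; rewrite !onthE map_drop nth_drop. Qed.

Lemma fi_onth_None u n m : n <= m -> fi_onth u n = None -> fi_onth u m = None.
Proof.
case: u => [s|f] //= nm h; apply: onth_default; apply: leq_trans nm.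
by rewrite -onthNE h.
Qed.

Definition cnt w n := count (isSome \o w) (iota 0 n).

Lemma cntS w n : cnt w n.+1 = cnt w n + isSome (w n).
Proof. by rewrite /cnt -addn1 iotaD count_cat /= addn0. Qed.

Lemma cntSl w n : cnt w n.+1 = isSome (w 0) + cnt (w \o succn) n.
Proof. by rewrite /cnt /= (iotaDl 1 0 n) count_map. Qed.

Lemma leq_cnt w n m : n <= m -> cnt w n <= cnt w m.
Proof.
move=> /subnK <-; elim: (m - n) => // k IH.
by rewrite addSn cntS (leq_trans IH) ?leq_addr.
Qed.

Lemma cnt_inj w n m : isSome (w n) -> isSome (w m) -> cnt w n = cnt w m -> n = m.
Proof.
have lt i j : isSome (w i) -> i < j -> cnt w i < cnt w j.
  by move=> wi ij; apply: leq_trans (leq_cnt w ij); rewrite cntS wi addn1.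
move=> wn wm e; case: (ltngtP n m) => // h.
- by have := lt _ _ wn h; rewrite e ltnn.
- by have := lt _ _ wm h; rewrite e ltnn.
Qed.

(** A relational specification of deleting idle positions. Filters and maps are compared through it,
    which confines the finite/infinite split and [kth_pos] to a few lemmas. *)
Definition collapses w u := forall k x,
  fi_onth u k = Some x <-> exists2 n, w n = Some x & cnt w n = k.

Lemma collapses_uniq w u v : collapses w u -> collapses w v -> u = v.
Proof.
move=> hu hv; apply: fi_onth_ext => k.
case eu: (fi_onth u k) => [x|].
  by apply/esym/hv/hu.
by case ev: (fi_onth v k) => [x|] //; move/hv/hu: ev; rewrite eu.
Qed.

Lemma collapses_nil w : (forall n, w n = None) -> collapses w (Fin [::]).
Proof. by move=> h k x; split=> [|[n]]; [case: k|rewrite h]. Qed.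

Lemma collapses_cons w s :
  collapses (w \o succn) (Fin s) ->
  collapses w (Fin (if w 0 is Some x then x :: s else s)).
Proof.
move=> h k y; case w0: (w 0) => [x|] /=.
- case: k => [|k] /=; split.
  + by case=> <-; exists 0.
  + by case=> -[|n]; rewrite ?cntSl w0 // => ->.
  + by move/h => [n wn <-]; exists n.+1; rewrite ?cntSl ?w0.
  + case=> -[|n] wn //; rewrite cntSl w0 add1n => -[e].
    by apply/h; exists n.
- split.
  + by move/h => [n wn <-]; exists n.+1; rewrite ?cntSl ?w0.
  + case=> -[|n] wn; first by rewrite wn in w0.
    by rewrite cntSl w0 add0n => e; apply/h; exists n.
Qed.

Lemma kth_posP Y (p : pred Y) (f : nat -> Y) (h : inf_often p f) w k :
  (forall n, isSome (w n) = p (f n)) ->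
  isSome (w (kth_pos h k)) /\ cnt w (kth_pos h k) = k.
Proof.
move=> wp.
(* Minimality in [ex_minn] makes all positions skipped by [kth_pos] idle, and [cnt] is constant
   along them. *)
have gap i j : i <= j -> (forall n, i <= n < j -> ~~ isSome (w n)) ->
    cnt w j = cnt w i.
  move=> /subnK <-; elim: (j - i) => // d IH hn.
  rewrite addSn cntS IH; last by move=> n hn'; apply: hn; lia.
  by rewrite (negbTE (hn _ _)) ?addn0 //; lia.
elim: k => [|k [IH1 IH2]] /=; case: ex_minnP => m.
- move=> pm minm; split; first by rewrite wp.
  rewrite (@gap 0) // => n /andP[_ nm]; rewrite wp; apply/negP => pn.
  by have := minm n; rewrite /= pn => /(_ isT); lia.
- move=> /andP[lem pm] minm; split; first by rewrite wp.
  rewrite (@gap (kth_pos h k).+1) //; last first.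
    move=> n /andP[kn nm]; rewrite wp; apply/negP => pn.
    by have := minm n; rewrite kn pn => /(_ isT); lia.
  by rewrite cntS IH1 IH2 addn1.
Qed.

Lemma collapses_Inf w (f : nat -> X) :
  (forall k, exists2 n, w n = Some (f k) & cnt w n = k) -> collapses w (Inf f).
Proof.
move=> h k x; split=> [[<-]|[n wn e]]; first exact: h.
have [m wm e'] := h k.
have enm : n = m by apply: (@cnt_inj w); rewrite ?wn ?wm // e e'.
by move: wn; rewrite enm wm.
Qed.

Lemma collapse_exists w : exists u, collapses w u.
Proof.
have [h|h] := pselect (inf_often isSome w).
- have hk := @kth_posP _ _ _ h w ^~ (fun=> erefl).
  (* [X] may be empty, so the default [x0] is taken from [w] itself. *)
  case w0: (w (kth_pos h 0)) => [x0|]; last by have [] := hk 0; rewrite w0.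
  exists (Inf (fun k => odflt x0 (w (kth_pos h k)))).
  apply: collapses_Inf => k; exists (kth_pos h k); last by have [] := hk k.
  by have [] := hk k; case: (w _).
- have [N hN] : exists N, forall n, N <= n -> w n = None.
    apply: contrapT => hn; apply: h => m; apply: contrapT => hm.
    apply: hn; exists m => n mn; case wn: (w n) => [x|] //.
    by exfalso; apply: hm; exists n; rewrite mn wn.
  elim: N w hN {h} => [|N IH] w hN.
    by exists (Fin [::]); apply: collapses_nil => n; apply: hN.
  have [|[s|f] hu] := IH (w \o succn); first by move=> n le; apply: hN.
    by eexists; apply: collapses_cons hu.
  (* An infinite collapse of the tail is impossible: its entry [N] has [N] non-idle positions before
     it, hence position at least [N], where the tail is idle. *)
  have /hu[n wn en] : fi_onth (Inf f) N = Some (f N) by [].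
  case: (ltnP n N) => nN; last by rewrite /= hN in wn.
  have := count_size (isSome \o (w \o succn)) (iota 0 n).
  by rewrite -/(cnt _ _) en size_iota; lia.
Qed.

(** Filtering that keeps positions, so that two runs can be compared before idle steps are squeezed
    out. *)
Definition owhen p w n :=
  if w n is Some x then if p x then Some x else None else None.

Lemma owhenP p w n x : owhen p w n = Some x <-> w n = Some x /\ p x.
Proof.
rewrite /owhen; case: (w n) => [y|]; last by split=> [|[]].
case: ifP => py; split=> //; first by case=> <-.
- by case.
- by case=> -[<-]; rewrite py.
Qed.

Lemma collapses_filter p u : collapses (owhen p (fi_onth u)) (fi_filter p u).
Proof.
have fin s : collapses (owhen p (onth s)) (Fin (filter p s)).
  elim: s => [|x s IH] /=; first by apply: collapses_nil => -[].
  have := @collapses_cons (owhen p (onth (x :: s))) (filter p s) IH.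
  by rewrite /owhen /=; case: (p x).
case: u => [s|f] /=; first exact: fin.
case: pselect => h.
- apply: collapses_Inf => k.
  have [|h1 h2] := @kth_posP _ _ _ h (owhen p (fi_onth (Inf f))) k.
    by move=> n; rewrite /owhen /=; case: (p _).
  by exists (kth_pos h k) => //; move: h1; rewrite /owhen /=; case: (p _).
- set N := xget _ _.
  have hN : forall n, N <= n -> ~~ p (f n).
    apply: (@xgetPex _ 0 (fun m => forall n, m <= n -> ~~ p (f n))).
    apply: contrapT => hn; apply: h => m; apply: contrapT => hm.
    apply: hn; exists m => n mn; apply/negP => pn.
    by apply: hm; exists n; rewrite mn pn.
  suff -> : owhen p (fi_onth (Inf f)) = owhen p (onth (mkseq f N)) by apply: fin.
  apply: funext => n; rewrite /owhen /= onthE.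
  case: (ltnP n N) => nN; last first.
    by rewrite nth_default ?size_map ?size_iota // (negbTE (hN _ nN)).
  by rewrite (nth_map (f 0)) ?size_mkseq // nth_mkseq.
Qed.

Lemma collapses_owhen p w u :
  collapses w u -> collapses (owhen p w) (fi_filter p u).
Proof.
move=> h.
(* Filtering commutes with collapsing because the index of an entry can be counted in two stages,
   first in [u] and then among the entries kept. *)
have ecnt n : cnt (owhen p w) n = cnt (owhen p (fi_onth u)) (cnt w n).
  elim: n => // n IH; rewrite cntS IH (cntS w) [owhen p w n]/owhen.
  case wn: (w n) => [x|] /=; last by rewrite !addn0.
  rewrite addn1 cntS; congr (_ + _).
  suff /h e : exists2 m, w m = Some x & cnt w m = cnt w n by rewrite /owhen e.
  by exists n.
move=> k x; rewrite (collapses_filter p u k x).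
split=> -[n /owhenP[e px] <-].
- have [m wm <-] := (h n x).1 e.
  by exists m; rewrite ?ecnt //; apply/owhenP.
- exists (cnt w n); rewrite ?ecnt //; apply/owhenP; split=> //.
  by apply/h; exists n.
Qed.

End Stuttering.

Lemma fi_onth_map X Y (g : X -> Y) u k :
  fi_onth (fi_map g u) k = omap g (fi_onth u k).
Proof.
by case: u => [s|f] //=; rewrite onth_map.
Qed.

Lemma collapses_map X Y (g : X -> Y) w u :
  collapses w u -> collapses (omap g \o w) (fi_map g u).
Proof.
move=> h k y; rewrite fi_onth_map.
have e n : cnt (omap g \o w) n = cnt w n.
  by apply: eq_count => i /=; case: (w i).
split.
- case eu: (fi_onth u k) => [x|] //= -[<-].
  by have [n wn <-] := (h k x).1 eu; exists n; rewrite /= ?wn ?e.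
- case=> n /=; case wn: (w n) => [x|] //= -[<-] en.
  suff /h -> : exists2 n, w n = Some x & cnt w n = k by [].
  by exists n; rewrite // -e.
Qed.

(* A stuttering run: [ac n = None] is an idle step, so finite and infinite paths
   become functions on [nat]. *)
Record stutter_run (L : finType) (P : lts L) (st : nat -> state P)
    (ac : nat -> option L) : Prop := StutterRun {
  stutter0 : st 0 = init P;
  stutterS : forall n, if ac n is Some a then trans (st n) a (st n.+1)
                       else st n.+1 = st n
}.

(** Abstract in the enabledness predicate, so as to cover plain LTSs as well as the component-wise
    [menabled]. *)
Definition stutter_just (L : Type) (en : nat -> L -> Prop) (B : pred L)
    (conc : rel L) (ac : nat -> option L) :=
  forall n a, ~~ B a -> en n a ->
  exists m b, [/\ n <= m, ac m = Some b & ~~ conc a b].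

Lemma weak_completed_tracesP (L : finType) (P : lts L) (B : {set L})
    (conc : rel L) (vis : pred L) w :
  weak_completed_traces P B conc vis w <->
  exists (st : nat -> state P) (ac : nat -> option L),
    [/\ stutter_run st ac,
        stutter_just (fun n => enabled (st n)) (mem B) conc ac
      & collapses (owhen vis ac) w].
Proof.
split.
- case=> -[s0 u] [[/= hp hi] hj] ->.
  pose st := fix st n := if n is m.+1 then
    if fi_onth u m is Some x then x.2 else st m else s0.
  (* A finite path is padded by repeating its last state: [k] is [n] itself, or a position at which
     the path has ended. *)
  have stP n : exists2 k, state_at (Run s0 u) k = Some (st n) &
      k = n \/ fi_onth u k = None.
    elim: n => [|n [k e]]; first by exists 0; [|left].
    rewrite /=; case en: (fi_onth u n) => [[a s]|] ek.
      by exists n.+1; rewrite /= ?en //; left.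
    by exists k => //; right; case: ek => [->|].
  have stE n a s : fi_onth u n = Some (a, s) ->
      state_at (Run s0 u) n = Some (st n).
    case: n => // n en /=; case en': (fi_onth u n) => [x|] //.
    by rewrite (fi_onth_None (leqnSn n) en') in en.
  exists st, (fi_onth (fi_map fst u)); split; last exact: collapses_filter.
  + split=> // n; rewrite fi_onth_map /=.
    case en: (fi_onth u n) => [[a s]|] //=.
    by apply: hp (stE _ _ _ en) en.
  + move=> n a nB ea; have [k ek kn] := stP n.
    case en: (fi_onth u n) => [[a' s']|].
      have est := stE _ _ _ en.
      have [|b cb [i]] := hj n (Run (st n) (fi_drop n u)) _ a nB ea.
        by rewrite /suffix_at est.
      rewrite /actions fi_onth_map /= fi_onth_drop => ei.
      by exists (n + i), b; rewrite fi_onth_map ei leq_addr.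
    (* The suffix at [k] has no actions, so justness there is contradictory: nothing outside [B] is
       enabled in the final state. *)
    have [|b cb [i]] := hj k (Run (st n) (fi_drop k u)) _ a nB ea.
      by rewrite /suffix_at ek.
    rewrite /actions fi_onth_map /= fi_onth_drop => ei.
    have {}kn : fi_onth u k = None by case: kn => [->|].
    by rewrite (fi_onth_None (leq_addr i k) kn) in ei.
- case=> st [ac [hr hj hw]].
  pose al n := omap (fun a => (a, st n.+1)) (ac n).
  have [u hu] := collapse_exists al.
  have alP n a : ac n = Some a -> fi_onth u (cnt al n) = Some (a, st n.+1).
    by move=> e; apply/hu; exists n; rewrite // /al e.
  have atP n : state_at (Run (st 0) u) (cnt al n) = Some (st n).
    elim: n => // n IH; rewrite cntS {2}/al; have := stutterS hr n.
    case en: (ac n) => [a|] /=; last by move=> ->; rewrite addn0.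
    by move=> _; rewrite addn1 /= (alP _ _ en).
  (* Every position of the collapsed path comes from some position of the run, at which justness of
     the run can be invoked. *)
  have atE k s : state_at (Run (st 0) u) k = Some s ->
      exists2 i, cnt al i = k & st i = s.
    case: k => [[<-]|k] /=; first by exists 0.
    case ek: (fi_onth u k) => [[a s']|] //= -[<-].
    have [i] := (hu _ _).1 ek; rewrite {1}/al.
    case ei: (ac i) => [a'|] //= -[_ <-] <-.
    by exists i.+1; rewrite // cntS /al ei addn1.
  exists (Run (st 0) u); first split; first split.
  + move=> k s a s' ek /hu[i]; rewrite {1}/al; have := stutterS hr i.
    case ei: (ac i) => [a'|] //= tr [<- <-] e.
    by move: ek; rewrite -e atP => -[<-].
  + exact: stutter0 hr.
  + move=> k pi'; rewrite /suffix_at.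
    case ek: (state_at _ k) => [s|] //= -[<-] a nB /= ea.
    have [i ei es] := atE _ _ ek; rewrite -es in ea.
    have [m [b [im em cb]]] := hj i a nB ea.
    exists b => //; exists (cnt al m - k).
    rewrite /actions fi_onth_map /= fi_onth_drop subnKC ?(alP _ _ em) //.
    by rewrite -ei leq_cnt.
  + apply: collapses_uniq hw _; apply: collapses_owhen.
    suff -> : ac = omap fst \o al by apply: collapses_map.
    by apply: funext => n; rewrite /al /=; case: (ac n).
Qed.

(** * Closure of reachability under transitions *)

Section Reachability.
Variables (L : finType) (P : lts L).

Lemma reachable_init : reachable (init P).
Proof.
exists (Run (init P) (Fin [::])); last by exists 0.
by split=> // n s a s' _; case: n.
Qed.

Lemma reachable_trans (s s' : state P) a :
  reachable s -> trans s a s' -> reachable s'.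
Proof.
case=> -[s0 u] [/= hp hi] [n en] tr.
(* The path witnessing reachability may continue past [s], even forever, so it is cut after [n]
   steps before being extended. *)
pose tk : seq (L * state P) :=
  if u is Inf f then mkseq f n else if u is Fin v then take n v else [::].
have szk : size tk = n /\ forall k, k < n -> onth tk k = fi_onth u k.
  rewrite /tk; case: u en {hp tk} => [v|f] en /=.
  - have nv : n <= size v.
      case: n en => // n /=.
      by rewrite -onthTE; case: (onth v n).
    split=> [|k kn]; first by rewrite size_takel.
    by rewrite !onthE map_take nth_take.
  - rewrite size_mkseq; split=> // k kn.
    by rewrite onthE (nth_map (f 0)) ?size_mkseq // nth_mkseq.
case: szk => szk onk.
pose pi := Run s0 (Fin (rcons tk (a, s'))).
have stk k : k <= n -> state_at pi k = state_at (Run s0 u) k.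
  case: k => //= k kn; rewrite -cats1 onth_cat szk kn onk //.
exists pi; last first.
  by exists n.+1; rewrite /= -cats1 onth_cat szk ltnn subnn.
split=> // k t b t' ek; rewrite /= -cats1 onth_cat szk.
case: ltnP => [kn|].
  by rewrite onk // => ek'; apply: hp ek'; rewrite -ek stk // ltnW.
rewrite leq_eqVlt => /orP[/eqP ek'|nk]; last first.
  by rewrite onth_default //= subn_gt0.
rewrite -ek' subnn /= => -[<- <-].
by move: ek; rewrite -ek' stk // en => -[<-].
Qed.

End Reachability.

(** * Runs of thread-register models *)

Section RegisterSteps.
Variables (G : signature) (r : rid G).
Implicit Types (s : status r) (rg wg : status r -> tid G -> bool).

(** Inversion by the shape of the action. The type of a value depends on its register, so values are
    tied down by equations between whole actions. *)
Lemma register_transP rg wg s a s' : register_trans rg wg s a s' ->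
  match a with
  | Sr t r' => [/\ r' = r, rg s t & s' = usr s t]
  | Sw t r' _ => [/\ r' = r, wg s t & exists2 d, a = Sw t r d & s' = usw s t d]
  | Or t r' => [/\ r' = r, t \in rds s :&: pend s & s' = uor s t]
  | Ow t r' => [/\ r' = r, t \in wrts s :&: pend s & s' = uow s t (rcd s t)]
  | Fr t r' _ => [/\ a = Fr t r (rcd s t), t \in rds s :\: pend s & s' = ufr s t]
  | Fw t r' => [/\ r' = r, t \in wrts s :\: pend s & s' = ufw s t (stor s)]
  | Loc _ _ => False
  end.
Proof. by case=> //= *; split=> //; eexists. Qed.

Lemma register_trans_guard rg wg rg' wg' s a s' :
  register_trans rg wg s a s' ->
  (forall t, a = Sr t r -> rg' s t) -> (forall t d, a = Sw t r d -> wg' s t) ->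
  register_trans rg' wg' s a s'.
Proof.
case=> {s a s'} s t; try by move=> h _ _; constructor.
- by move=> _ /(_ t erefl) h _; constructor.
- by move=> d _ _ /(_ t d erefl) h; constructor.
Qed.

(** The list stops short of [ovrl] and [posv], which a write started by another thread does
    change. *)
Lemma register_trans_frame rg wg s a s' t :
  register_trans rg wg s a s' -> thr a <> t ->
  [/\ (t \in rds s') = (t \in rds s), (t \in wrts s') = (t \in wrts s),
      (t \in pend s') = (t \in pend s) & rcd s' t = rcd s t].
Proof.
by case=> {s a s'} s t0 => [_|d _|_|_|_|_] /= /eqP;
  rewrite eq_sym => /negbTE nt; split; rewrite ?inE ?ffunE ?nt.
Qed.

End RegisterSteps.

Section Model.
Variables (G : signature) (T : tid G -> lts (act G)).
Hypothesis hT : forall t : tid G, is_thread t (T t).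
Implicit Types (t : tid G) (r : rid G) (a b : act G).

(** The atomic model and its three variants are all instances of one model with free guards, so
    facts about runs are proved once. *)
Definition guard := forall r, status r -> tid G -> bool.
Definition gmodel (rg wg : guard) :=
  model T (fun r => register_lts (@rg r) (@wg r)).

Section Run.
Variables (rg wg : guard).
Variables (th : nat -> forall t, state (T t)) (q : nat -> forall r, status r).
Variable ac : nat -> option (act G).

(** A stuttering run unbundled into one state sequence per thread and per register; [WCT_mrun]
    translates once and for all from product states. *)
Record mrun : Prop := MRun {
  run_thr0 : forall t, th 0 t = init (T t);
  run_reg0 : forall r, q 0 r = init_status r;
  run_thr : forall n a, ac n = Some a -> ~~ register_local a ->
    trans (th n (thr a)) a (th n.+1 (thr a));
  run_thr_id : forall n t,
    (forall a, ac n = Some a -> thr a = t -> register_local a) ->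
    th n.+1 t = th n t;
  run_reg : forall n a r, ac n = Some a -> reg a = Some r ->
    register_trans (@rg r) (@wg r) (q n r) a (q n.+1 r);
  run_reg_id : forall n r, (forall a, ac n = Some a -> reg a <> Some r) ->
    q n.+1 r = q n r
}.

Definition menabled n a :=
  (~~ register_local a -> enabled (th n (thr a)) a) /\
  (forall r, reg a = Some r ->
     exists s', register_trans (@rg r) (@wg r) (q n r) a s').

Definition mjust C := stutter_just menabled (mem (nc_actions G)) (conc C) ac.

End Run.

Lemma mem_thread_alphabet t a :
  (a \in alphabet (T t)) = (thr a == t) && ~~ register_local a.
Proof. by rewrite (thread_actions (hT t)) inE. Qed.

Lemma mem_par_alphabet (rg wg : guard) a :
  a \in par_alphabet (fun i : tid G + rid G =>
     match i with inl t => T t | inr r => register_lts (@rg r) (@wg r) end).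
Proof.
apply/bigcupP; case e: (register_local a).
  by case: a e => // t r _; exists (inr r); rewrite //= inE.
by exists (inl (thr a)); rewrite //= mem_thread_alphabet e eqxx.
Qed.

Lemma menabledP (rg wg : guard) (s : state (gmodel rg wg)) a :
  enabled s a <->
  (~~ register_local a ->
     enabled ((s : par_state _) (inl (thr a)) : state (T _)) a) /\
  (forall r, reg a = Some r -> exists s',
     register_trans (@rg r) (@wg r) ((s : par_state _) (inr r)) a s').
Proof.
split.
- case=> s' [_ h]; split.
  + move=> na; have := h (inl (thr a)); rewrite mem_thread_alphabet eqxx na.
    by exists ((s' : par_state _) (inl (thr a))).
  + move=> r ra; have := h (inr r); rewrite /= inE ra eqxx.
    by exists ((s' : par_state _) (inr r)).
- case=> h1 h2.
  pose R (i : tid G + rid G) := match i with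
    | inl t => T t | inr r => register_lts (@rg r) (@wg r) end.
  have h i : exists x : state (R i), if a \in alphabet (R i)
      then trans ((s : par_state R) i) a x else x = (s : par_state R) i.
    case ha: (a \in alphabet (R i)); last by eexists.
    case: i ha => [t|r] /=.
      by rewrite mem_thread_alphabet => /andP[/eqP <- na]; apply: h1.
    by rewrite inE => /eqP ra; apply: h2.
  (* The components are only known to have targets; choice assembles them into a global one. *)
  exists ([ffun i => projT1 (cid (h i))] : par_state R).
  split; first exact: mem_par_alphabet.
  by move=> i; rewrite ffunE; exact: (projT2 (cid (h i))).
Qed.

Lemma WCT_mrun C (rg wg : guard) w :
  WCT C (gmodel rg wg) w <->
  exists th q ac, [/\ mrun rg wg th q ac, mjust rg wg th q ac C
                    & collapses (owhen (@visible G) ac) w].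
Proof.
pose R (i : tid G + rid G) := match i with
    | inl t => T t | inr r => register_lts (@rg r) (@wg r) end.
rewrite /WCT weak_completed_tracesP; split.
- case=> st [ac [hr hj hw]].
  exists (fun n t => (st n : par_state R) (inl t)).
  exists (fun n r => (st n : par_state R) (inr r)), ac; split=> //.
  + have h n := stutterS hr n.
    split.
    * by move=> t; rewrite (stutter0 hr) /= ffunE.
    * by move=> r; rewrite (stutter0 hr) /= ffunE.
    * move=> n a ea na; have := h n; rewrite ea => -[_ /(_ (inl (thr a)))].
      by rewrite mem_thread_alphabet eqxx na.
    * move=> n t ht; have := h n; case ea: (ac n) => [a|]; last by move=> ->.
      case=> _ /(_ (inl t)); rewrite mem_thread_alphabet.
      by case: eqP => //= et; rewrite (ht a).
    * move=> n a r ea ra; have := h n; rewrite ea => -[_ /(_ (inr r))].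
      by rewrite /= inE ra eqxx.
    * move=> n r ht; have := h n; case ea: (ac n) => [a|]; last by move=> ->.
      by case=> _ /(_ (inr r)); rewrite /= inE; case: eqP => // /(ht a ea).
  + move=> n a nB ea; apply: hj nB _; exact/menabledP.
- case=> th [q [ac [hr hj hw]]].
  pose st n : par_state R := [ffun i => match i return state (R i) with
    inl t => th n t | inr r => q n r end].
  have stl n t : (st n) (inl t) = th n t by rewrite ffunE.
  have str n r : (st n) (inr r) = q n r by rewrite ffunE.
  exists st, ac; split=> //; first split.
  + apply/ffunP => -[t|r]; rewrite !ffunE /=.
      exact: run_thr0 hr t.
    exact: run_reg0 hr r.
  + move=> n; case ea: (ac n) => [a|]; last first.
      apply/ffunP => -[t|r]; rewrite !ffunE /=.
        by apply: run_thr_id hr _ _ _; rewrite ea.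
      by apply: run_reg_id hr _ _ _; rewrite ea.
    split; first exact: mem_par_alphabet.
    case=> [t|r]; rewrite /= !ffunE.
      rewrite mem_thread_alphabet; case: eqP => [<-|et] /=.
        case: ifP => na; first exact: run_thr hr _ _ ea na.
        apply: run_thr_id hr _ _ _ => b; rewrite ea => -[<-] _.
        by rewrite -(negbK (register_local a)) na.
      by apply: run_thr_id hr _ _ _ => b; rewrite ea => -[<-].
    rewrite inE; case: eqP => ra; first exact: run_reg hr _ _ _ ea ra.
    by apply: run_reg_id hr _ _ _ => b; rewrite ea => -[<-].
  + move=> n a nB /menabledP [h1 h2]; apply: hj nB _; split.
      by move=> /h1; rewrite stl.
    by move=> r /h2; rewrite str.
Qed.

Lemma thread_waits_read t r (x : state (T t)) a :
  (exists2 s, reachable s & trans s (Sr t r) x) ->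
  enabled x a <-> exists d, a = Fr t r d.
Proof. by case=> s rs tr; apply: (thread_sr (hT t) rs tr). Qed.

Lemma thread_waits_write t r (x : state (T t)) a :
  (exists2 s, reachable s & exists d, trans s (Sw t r d) x) ->
  enabled x a <-> a = Fw t r.
Proof. by case=> s rs [d tr]; apply: (thread_sw (hT t) rs tr). Qed.

(** * What a thread can do while a register lists it *)

Section RunTheory.
Variables (rg wg : guard).
Variables (th : nat -> forall t, state (T t)) (q : nat -> forall r, status r).
Variable ac : nat -> option (act G).
Hypothesis hr : mrun rg wg th q ac.

Lemma run_enabled n a : ac n = Some a -> ~~ register_local a ->
  enabled (th n (thr a)) a.
Proof. by move=> ea na; exists (th n.+1 (thr a)); apply: run_thr hr _ _ ea na. Qed.

Lemma run_reachable n t : reachable (th n t).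
Proof.
elim: n => [|n IH]; first by rewrite (run_thr0 hr); apply: reachable_init.
have [[a [ea et na]]|h] := pselect (exists a, [/\ ac n = Some a, thr a = t
    & ~~ register_local a]).
  by move: IH; rewrite -et => IH; apply: reachable_trans IH (run_thr hr ea na).
rewrite (run_thr_id hr) // => a ea et; apply: contrapT => /negP na.
by apply: h; exists a.
Qed.

(** Ties register bookkeeping to thread states: a listed thread sits in a state entered by the
    matching start. There only the matching finish is enabled, and performing it removes the thread
    from the list. *)
Lemma run_waits n t r :
  (t \in rds (q n r) -> exists2 s, reachable s & trans s (Sr t r) (th n t)) /\
  (t \in wrts (q n r) ->
     exists2 s, reachable s & exists d, trans s (Sw t r d) (th n t)).
Proof.
elim: n => [|n [IHr IHw]]; first by rewrite (run_reg0 hr) !inE.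
have [[a [ea et na]]|h] := pselect (exists a, [/\ ac n = Some a, thr a = t
    & ~~ register_local a]); last first.
  have -> : th n.+1 t = th n t.
    apply: run_thr_id hr _ _ _ => a ea et; apply: contrapT => /negP na.
    by apply: h; exists a.
  have [[a [ea ra]]|h'] := pselect (exists a, ac n = Some a /\ reg a = Some r);
    last first.
    rewrite (run_reg_id hr); first by split.
    by move=> a ea ra; apply: h'; exists a.
  have tr := run_reg hr ea ra.
  have [et|nt] := eqVneq (thr a) t.
    have la : register_local a.
      by apply: contrapT => /negP na; apply: h; exists a.
    by have := register_transP tr; case: a la {et ra ea tr} => // t0 r0 _ [_ _ ->].
  by have [-> -> _ _] := register_trans_frame tr (elimN eqP nt).
have en := run_enabled ea na.
have tr := run_thr hr ea na.
rewrite -et; rewrite -et in IHr IHw.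
(* A step of the thread that avoids [r] excludes waiting at [r], since a waiting thread could only
   finish there. *)
have [ra|ra] := pselect (reg a = Some r); last first.
  rewrite (run_reg_id hr); last by move=> b; rewrite ea => -[<-].
  split=> [/IHr|/IHw] w.
    by have [d e] := (thread_waits_read _ w).1 en; rewrite e in ra.
  by have e := (thread_waits_write _ w).1 en; rewrite e in ra.
have := register_transP (run_reg hr ea ra).
have rc := run_reachable n (thr a).
case: a {ea et ra} IHr IHw en tr na rc => //= t0 r0.
- move=> IHr IHw en tr _ rc [e0 _ ->] /=; subst r0; split; first by exists (th n t0).
  by move=> /IHw /thread_waits_write -/(_ (Sr t0 r)) [/(_ en)].
- move=> d IHr IHw en tr _ rc [e0 _ ->] /=; split; first by rewrite !inE eqxx.
  by move=> /IHw /thread_waits_write -/(_ (Fr t0 r0 d)) [/(_ en)].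
- move=> d IHr IHw en tr _ rc [e0 _ [d' _ ->]] /=; subst r0; split.
    by move=> /IHr /thread_waits_read -/(_ (Sw t0 r d)) [/(_ en) []].
  by exists (th n t0) => //; exists d.
- move=> IHr IHw en tr _ rc [e0 _ ->] /=; split; last by rewrite !inE eqxx.
  by move=> /IHr /thread_waits_read -/(_ (Fw t0 r0)) [/(_ en) []].
Qed.

Lemma run_reads n t r a : t \in rds (q n r) ->
  enabled (th n t) a <-> exists d, a = Fr t r d.
Proof. by move=> /(run_waits n t r).1; apply: thread_waits_read. Qed.

Lemma run_writes n t r a : t \in wrts (q n r) ->
  enabled (th n t) a <-> a = Fw t r.
Proof. by move=> /(run_waits n t r).2; apply: thread_waits_write. Qed.

Definition busy n t r := t \in rds (q n r) :|: wrts (q n r).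
Definition idle n t := [forall r, ~~ busy n t r].

(** Finish steps alone remove [t] from [rds] or [wrts], and they are refused while [t] is
    pending. *)
Lemma run_pend n t r : t \in pend (q n r) -> busy n t r.
Proof.
rewrite /busy; elim: n => [|n IH]; first by rewrite (run_reg0 hr) inE.
have [[a [ea ra]]|h] := pselect (exists a, ac n = Some a /\ reg a = Some r);
  last first.
  by rewrite (run_reg_id hr) // => a ea ra; apply: h; exists a.
have tr := run_reg hr ea ra.
have [et|nt] := eqVneq (thr a) t; last first.
  by have [e1 e2 e3 _] := register_trans_frame tr (elimN eqP nt);
    rewrite inE e1 e2 e3 -in_setU.
have := register_transP tr; rewrite -et.
case: a {ea ra tr et} => //= t0 r0.
- by move=> [_ _ ->]; rewrite !inE eqxx.
- by move=> d [_]; rewrite inE => /andP[/negbTE np _] ->; rewrite /= np.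
- by move=> d [_ _ [d' _ ->]]; rewrite !inE eqxx orbT.
- by move=> [_]; rewrite inE => /andP[/negbTE np _] ->; rewrite /= np.
- by move=> [_ _ ->]; rewrite /= !inE eqxx.
- by move=> [_ _ ->]; rewrite /= !inE eqxx.
Qed.

Lemma read_write_disjoint n t r r' :
  t \in rds (q n r) -> t \in wrts (q n r') -> False.
Proof.
move=> /run_reads h1 /run_writes h2.
(* [dinit r] shows that [dom r] is inhabited, so a reading thread enables at least one
   finish-read. *)
have /h2 : enabled (th n t) (Fr t r (dinit r)) by apply/h1; exists (dinit r).
by [].
Qed.

Lemma busy_inj n t r r' : busy n t r -> busy n t r' -> r = r'.
Proof.
rewrite /busy !inE => /orP[h1|h1] /orP[h2|h2].
- have /(run_reads _ h2)[d [->]//] : enabled (th n t) (Fr t r (dinit r)).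
  by apply/(run_reads _ h1); exists (dinit r).
- by have := read_write_disjoint h1 h2.
- by have := read_write_disjoint h2 h1.
- have /(run_writes _ h2)[->//] : enabled (th n t) (Fw t r).
  by apply/(run_writes _ h1).
Qed.

Lemma idleP n t r : idle n t -> t \in rds (q n r) = false /\
   t \in wrts (q n r) = false.
Proof.
move=> /forallP /(_ r).
by rewrite /busy inE negb_or => /andP[/negbTE -> /negbTE ->].
Qed.

Lemma idle_pend n t r : idle n t -> t \in pend (q n r) = false.
Proof.
move=> /forallP /(_ r) nb; apply/negbTE; apply: contra nb; exact: run_pend.
Qed.

Lemma busyP n t : ~~ idle n t -> exists r, busy n t r.
Proof. by rewrite negb_forall => /existsP[r]; rewrite negbK; exists r. Qed.

(* The actions that a thread can only perform between two operations. *)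
Definition idle_act a := match a with
  Sr _ _ | Sw _ _ _ | Loc _ _ => true | _ => false end.

Lemma enabled_idle n t a : idle_act a -> enabled (th n t) a -> idle n t.
Proof.
move=> ia ea; apply/forallP => r; rewrite /busy inE negb_or.
apply/andP; split; apply/negP.
  by move=> /run_reads h; have [d e] := (h a).1 ea; rewrite e in ia.
by move=> /run_writes h; have e := (h a).1 ea; rewrite e in ia.
Qed.

Lemma idle_idle_act n a : ac n = Some a -> idle n (thr a) -> idle_act a.
Proof.
move=> ea ia; case e: (reg a) => [r|]; last by case: a e {ea ia}.
have [hrd hwr] := idleP r ia.
have := register_transP (run_reg hr ea e).
by case: a ea hrd hwr ia e => //= t0 r0 *;
  match goal with H : and3 _ _ _ |- _ => case: H end;
  rewrite inE => _ /andP[]; congruence.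
Qed.

Definition order_act n t r : act G :=
  if t \in rds (q n r) then Or t r else Ow t r.
Definition finish_act n t r : act G :=
  if t \in rds (q n r) then Fr t r (rcd (q n r) t) else Fw t r.

(** The thread offers only its finish action, which the register refuses as long as [t] is pending;
    what remains is ordering, at the only register where the thread is busy. *)
Lemma pend_act n a r : ac n = Some a -> thr a \in pend (q n r) ->
  a = order_act n (thr a) r.
Proof.
move=> ea pa; have ba := run_pend pa.
have [na|] := boolP (register_local a); last first.
  move=> /(run_enabled ea) en; rewrite /order_act.
  move: ba; rewrite /busy inE => /orP[] h.
    have [d e] := (run_reads _ h).1 en; rewrite h; exfalso.
    have := run_reg hr (r := r) ea; rewrite {1}e => /(_ erefl).
    move/register_transP; rewrite {1}e => -[_].
    rewrite e /= in pa *; by rewrite inE pa.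
  have e := (run_writes _ h).1 en; exfalso.
  have := run_reg hr (r := r) ea; rewrite {1}e => /(_ erefl).
  move/register_transP; rewrite {1}e => -[_].
  rewrite e /= in pa *; by rewrite inE pa.
case: a na ea pa ba => // t r' _ ea /= pa ba; rewrite /order_act.
- have [_ + _] := register_transP (run_reg hr (r := r') ea erefl).
  rewrite inE => /andP[h _].
  have er : r = r' by apply: busy_inj ba _; rewrite /busy inE h.
  by rewrite er h.
- have [_ + _] := register_transP (run_reg hr (r := r') ea erefl).
  rewrite inE => /andP[h _].
  have er : r = r' by apply: busy_inj ba _; rewrite /busy inE h orbT.
  by rewrite er; case: ifP => // /read_write_disjoint /(_ h).
Qed.

Lemma post_act n a r : ac n = Some a -> busy n (thr a) r ->
  thr a \notin pend (q n r) -> a = finish_act n (thr a) r.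
Proof.
move=> ea ba pa.
have [na|] := boolP (register_local a).
  case: a na ea pa ba => // t r' _ ea /= pa ba; exfalso.
  - have [_ + _] := register_transP (run_reg hr (r := r') ea erefl).
    rewrite inE => /andP[h].
    have -> : r' = r by apply: busy_inj ba; rewrite /busy inE h.
    by rewrite (negbTE pa).
  - have [_ + _] := register_transP (run_reg hr (r := r') ea erefl).
    rewrite inE => /andP[h].
    have -> : r' = r by apply: busy_inj ba; rewrite /busy inE h orbT.
    by rewrite (negbTE pa).
move=> /(run_enabled ea) en; rewrite /finish_act.
case: ifP => h.
  have [d e] := (run_reads _ h).1 en.
  have := run_reg hr (r := r) ea; rewrite {1}e => /(_ erefl).
  by move/register_transP; rewrite {1}e => -[+ _ _]; rewrite {2}e => <-.
by move: ba; rewrite /busy inE h => h'; apply: (run_writes _ h').1 en.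
Qed.

(** The part of the global state that only [t] changes; [stor] is left out, as other threads
    overwrite it. *)
Definition same n m t := th m t = th n t /\ forall r,
  [/\ (t \in rds (q m r)) = (t \in rds (q n r)),
      (t \in wrts (q m r)) = (t \in wrts (q n r)),
      (t \in pend (q m r)) = (t \in pend (q n r))
    & rcd (q m r) t = rcd (q n r) t].

Lemma same_step n t : (forall a, ac n = Some a -> thr a <> t) -> same n n.+1 t.
Proof.
move=> h; split; first by apply: run_thr_id hr _ _ _ => a /h.
move=> r.
have [[a [ea ra]]|h'] := pselect (exists a, ac n = Some a /\ reg a = Some r).
  exact: register_trans_frame (run_reg hr ea ra) (h a ea).
by rewrite (run_reg_id hr) // => a ea ra; apply: h'; exists a.
Qed.

Lemma same_idle n m t : same n m t -> idle m t = idle n t.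
Proof.
by case=> _ h; apply: eq_forallb => r; case: (h r); rewrite /busy !inE => -> ->.
Qed.

Lemma same_trans n m k t : same n m t -> same m k t -> same n k t.
Proof.
case=> e h [e' h']; split; first by rewrite e'.
by move=> r; case: (h r) => <- <- <- <-.
Qed.

Lemma same_many n m t : n <= m ->
  (forall k a, n <= k < m -> ac k = Some a -> thr a <> t) -> same n m t.
Proof.
move=> /subnK <-; elim: (m - n) => [|d IH] h; first by split.
apply: (same_trans (m := d + n)).
  by apply: IH => k a hk; apply: h; lia.
by apply: same_step => a; apply: h; lia.
Qed.

(** Justness promises just some action of a thread. Going back to the first one keeps the thread as
    it was at [n], which determines what that action is. *)
Lemma first_action n m b : n <= m -> ac m = Some b ->
  exists k a, [/\ n <= k <= m, ac k = Some a, thr a = thr b & same n k (thr b)].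
Proof.
move=> nm em.
pose P k := (n <= k) && (if ac k is Some a then thr a == thr b else false).
have exP : exists k, P k by exists m; rewrite /P nm em /=.
case: (ex_minnP exP) => k /andP[nk]; case ek: (ac k) => [a|] // /eqP ea mink.
exists k, a; split=> //; first by rewrite nk; apply: mink; rewrite /P nm em /=.
apply: same_many => // j c /andP[nj jk] ej ec.
by have := mink j; rewrite /P nj ej ec eqxx => /(_ isT); lia.
Qed.

(** * Progress of operations under justness *)

Section Just.
Variable C : criterion.
Hypothesis hj : mjust rg wg th q ac C.

Lemma conc_thr a b : thr a = thr b -> ~~ conc C a b.
Proof. by move=> e; case: C; rewrite /= /concA /concI /concS /concT e eqxx. Qed.

Lemma conc_nonstart a b : ~~ is_sr a -> ~~ is_sw a ->
  conc C a b = (thr a != thr b).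
Proof.
by case: a => *; case: C; rewrite /= /concA /concI /concS /concT /= ?andbT.
Qed.

Lemma just_first n a : a \notin nc_actions G -> ~~ is_sr a -> ~~ is_sw a ->
  menabled rg wg th q n a ->
  exists m b, [/\ n <= m, ac m = Some b, thr b = thr a & same n m (thr a)].
Proof.
move=> na nsr nsw en; have [m [b [nm em]]] := hj na en.
rewrite conc_nonstart // negbK => /eqP ->.
have [k [c [/andP[nk _] ek ec sk]]] := first_action nm em.
by exists k, c.
Qed.

Lemma nc_actionsP a : a \in nc_actions G -> exists t l, a = Loc t l.
Proof. by case/imsetP=> t _ ->; exists t, (nc t). Qed.

(** The order action needs no cooperation of the thread, hence is enabled. Not being a start, it can
    be interfered with only by its own thread, whose first action must be the order itself. *)
Lemma eventually_order n t r : t \in pend (q n r) ->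
  exists m, [/\ n <= m, ac m = Some (order_act n t r) & same n m t].
Proof.
move=> pt; have bt := run_pend pt.
have ea : thr (order_act n t r) = t by rewrite /order_act; case: ifP.
have [||||m [b [nm em eb sm]]] := @just_first n (order_act n t r).
- by apply/negP => /nc_actionsP[t' [l]]; rewrite /order_act; case: ifP.
- by rewrite /order_act; case: ifP.
- by rewrite /order_act; case: ifP.
- split; first by rewrite /order_act; case: ifP.
  move=> r'; rewrite /order_act; case: ifP => h [<-]; eexists; constructor.
    by rewrite inE h.
  by move: bt; rewrite /busy !inE h pt /= => ->.
- rewrite ea in eb sm; exists m; split=> //.
  have [_ /(_ r) [s1 _ s3 _]] := sm.
  have {1}-> : order_act n t r = order_act m t r by rewrite /order_act s1.
  by rewrite em -eb; congr Some; apply: pend_act => //; rewrite eb s3.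
Qed.

(** As for ordering; the finish is enabled because a waiting reader accepts every value, in
    particular the recorded one. *)
Lemma eventually_finish n t r : busy n t r -> t \notin pend (q n r) ->
  exists m, [/\ n <= m, ac m = Some (finish_act n t r) & same n m t].
Proof.
move=> bt pt.
have ea : thr (finish_act n t r) = t by rewrite /finish_act; case: ifP.
have [||||m [b [nm em eb sm]]] := @just_first n (finish_act n t r).
- by apply/negP => /nc_actionsP[t' [l]]; rewrite /finish_act; case: ifP.
- by rewrite /finish_act; case: ifP.
- by rewrite /finish_act; case: ifP.
- split.
    rewrite ea => _; rewrite /finish_act; case: ifP => h.
      by apply/(run_reads _ h); eexists.
    by move: bt; rewrite /busy inE h => /run_writes h'; apply/h'.
  move=> r'; rewrite /finish_act; case: ifP => h [<-]; eexists; constructor.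
    by rewrite inE h pt.
  by move: bt; rewrite /busy !inE h pt /= => ->.
- rewrite ea in eb sm; exists m; split=> //.
  have [_ /(_ r) [s1 s2 s3 s4]] := sm.
  have {1}-> : finish_act n t r = finish_act m t r by rewrite /finish_act s1 s4.
  rewrite em -eb; congr Some; apply: post_act => //; rewrite eb ?s3 //.
  by move: bt; rewrite /busy !inE s1 s2.
Qed.

Lemma finish_idle n t r : busy n t r -> ac n = Some (finish_act n t r) ->
  idle n.+1 t.
Proof.
move=> bt en; apply/forallP => r'; apply/negP => b'.
have [er|nr] := eqVneq r' r; last first.
  have := b'; rewrite /busy (run_reg_id hr); last first.
    move=> a; rewrite en => -[<-]; rewrite /finish_act.
    by case: ifP => _ /= [e]; rewrite e eqxx in nr.
  by move=> b''; rewrite (busy_inj bt b'') eqxx in nr.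
subst r'; move: bt en b'; rewrite /busy /finish_act !inE.
case: ifP => h bt en.
  have [_ _ ->] := register_transP (run_reg hr (r := r) en erefl).
  rewrite /= !inE eqxx /= => h'; exact: read_write_disjoint h h'.
have [_ _ ->] := register_transP (run_reg hr (r := r) en erefl).
by rewrite /= h !inE eqxx.
Qed.

Lemma order_pend n t r : ac n = Some (order_act n t r) ->
  [/\ (t \in rds (q n.+1 r)) = (t \in rds (q n r)),
      (t \in wrts (q n.+1 r)) = (t \in wrts (q n r))
    & t \notin pend (q n.+1 r)].
Proof.
rewrite /order_act; case: ifP => h en;
  have [_ _ ->] := register_transP (run_reg hr (r := r) en erefl);
  by rewrite /= !inE eqxx.
Qed.

Lemma eventually_idle n t : exists m, (n <= m) && idle m t.
Proof.
have post k r : busy k t r -> t \notin pend (q k r) ->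
    exists m, (k <= m) && idle m t.
  move=> bt pt; have [m [km em sm]] := eventually_finish bt pt.
  exists m.+1; rewrite leqW //=; apply: (@finish_idle m t r).
    by case: sm => _ /(_ r) [s1 s2 _ _]; move: bt; rewrite /busy !inE s1 s2.
  by case: sm => _ /(_ r) [s1 _ _ s4]; rewrite em /finish_act s1 s4.
have [i|/busyP[r bt]] := boolP (idle n t); first by exists n; rewrite leqnn.
have [pt|pt] := boolP (t \in pend (q n r)); last exact: post bt pt.
have [m [nm em sm]] := eventually_order pt.
have em' : ac m = Some (order_act m t r).
  by case: sm => _ /(_ r) [s1 _ _ _]; rewrite em /order_act s1.
have [o1 o2 o3] := order_pend em'.
have [|k /andP[mk ik]] := post m.+1 r _ o3.
  by case: sm => _ /(_ r) [s1 s2 _ _]; move: bt; rewrite /busy !inE o1 o2 s1 s2.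
by exists k; rewrite ik andbT; lia.
Qed.

End Just.
End RunTheory.

(** * From the variants to the atomic registers *)

(** Guards matter only at starts, and a thread that starts is idle. *)
Lemma mrun_guard (rg wg rg' wg' : guard) th q ac : mrun rg wg th q ac ->
  (forall n t r, idle q n t -> ac n = Some (Sr t r) -> @rg' r (q n r) t) ->
  (forall n t r d, idle q n t -> ac n = Some (Sw t r d) -> @wg' r (q n r) t) ->
  mrun rg' wg' th q ac.
Proof.
move=> hr hsr hsw; split; try by case: hr.
move=> n a r ea ra; apply: register_trans_guard (run_reg hr ea ra) _ _.
  move=> t e; apply: hsr; rewrite -?e ?ea //.
  rewrite e in ea; apply: (enabled_idle hr (a := Sr t r)) => //.
  exact: (run_enabled hr ea).
move=> t d e; apply: (hsw _ _ _ d); rewrite -?e ?ea //.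
rewrite e in ea; apply: (enabled_idle hr (a := Sw t r d)) => //.
exact: (run_enabled hr ea).
Qed.

Definition atomic_guard : guard := fun r s t => t \notin rds s :|: wrts s.

Definition variant_rg C : guard := fun r s t => match C with
  | CritA => rds s :|: wrts s == set0
  | _ => (t \notin rds s) && (wrts s == set0)
  end.

Definition variant_wg C : guard := fun r s t => match C with
  | CritS => wrts s == set0
  | _ => rds s :|: wrts s == set0
  end.

Lemma variant_model C :
  model T (variant_register C) = gmodel (variant_rg C) (variant_wg C).
Proof. by case: C. Qed.

(** * Emptying a register when nothing interferes *)

Section Drain.
Variables (rg wg : guard) (th : nat -> forall t, state (T t)).
Variables (q : nat -> forall r, status r) (ac : nat -> option (act G)).
Variable C : criterion.
Hypotheses (hr : mrun rg wg th q ac) (hj : mjust rg wg th q ac C).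
Variables (n : nat) (r : rid G).

(** Applied to [rds] and to [wrts]. A set that never grows loses each member once that thread
    becomes idle, so induction on its size applies. *)
Lemma drain (ops : status r -> {set tid G}) :
  (forall m t, t \in ops (q m r) -> busy q m t r) ->
  (forall m, n <= m -> ops (q m.+1 r) \subset ops (q m r)) ->
  exists2 m, n <= m & ops (q m r) = set0.
Proof.
move=> hb hs.
have mono m k : n <= m -> m <= k -> ops (q k r) \subset ops (q m r).
  move=> nm /subnK <-; elim: (k - m) => // d IH.
  by rewrite addSn (subset_trans (hs _ _) IH) //; lia.
suff h c m : n <= m -> #|ops (q m r)| <= c ->
    exists2 m, n <= m & ops (q m r) = set0.
  exact: (h #|ops (q n r)| n).
elim: c m => [|c IH] m nm hc.
  by exists m => //; apply/eqP; rewrite -cards_eq0 -leqn0.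
have [e|[t tm]] := set_0Vmem (ops (q m r)); first by exists m.
have [k /andP[mk ik]] := eventually_idle hr hj m t.
apply: (IH k); first by lia.
rewrite -ltnS; apply: leq_trans hc; apply: proper_card.
rewrite properE mono //=; apply/negP => /subsetP /(_ t tm) /hb.
by apply/negP; move/forallP: ik.
Qed.

(** Monotonicity is returned along with emptiness, because [wrts] has to stay empty while the reads
    drain afterwards. *)
Lemma drain_writes :
  (forall m t d, n <= m -> ac m <> Some (Sw t r d)) ->
  (forall m, n <= m -> wrts (q m.+1 r) \subset wrts (q m r)) /\
  exists2 m, n <= m & wrts (q m r) = set0.
Proof.
move=> hn.
have hs m : n <= m -> wrts (q m.+1 r) \subset wrts (q m r).
  move=> nm.
  have [[a [ea ra]]|h] := pselect (exists a, ac m = Some a /\ reg a = Some r);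
    last by rewrite (run_reg_id hr) // => a ea ra; apply: h; exists a.
  have := register_transP (run_reg hr ea ra).
  case: a ea ra => //= t r0.
  - by move=> _ _ [_ _ ->].
  - by move=> d _ _ [_ _ ->].
  - by move=> d ea [er]; subst r0; have := hn m t d nm; rewrite ea.
  - by move=> _ _ [_ _ ->]; rewrite subD1set.
  - by move=> _ _ [_ _ ->].
  - by move=> _ _ [_ _ ->].
split=> //; apply: (drain (ops := @wrts G r)) hs.
by move=> m t; rewrite /busy inE => ->; rewrite orbT.
Qed.

Lemma drain_reads :
  (forall m t, n <= m -> ac m <> Some (Sr t r)) ->
  exists2 m, n <= m & rds (q m r) = set0.
Proof.
move=> hn.
apply: (drain (ops := @rds G r)).
  by move=> m t; rewrite /busy inE => ->.
move=> m nm.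
have [[a [ea ra]]|h] := pselect (exists a, ac m = Some a /\ reg a = Some r);
  last by rewrite (run_reg_id hr) // => a ea ra; apply: h; exists a.
have := register_transP (run_reg hr ea ra).
case: a ea ra => //= t r0.
- by move=> ea [er]; subst r0; have := hn m t nm; rewrite ea.
- by move=> d _ _ [_ _ ->]; rewrite subD1set.
- by move=> d _ _ [_ _ [d' _ ->]].
- by move=> _ _ [_ _ ->].
- by move=> _ _ [_ _ ->].
- by move=> _ _ [_ _ ->].
Qed.

End Drain.

(** This and the next two lemmas mirror the variant guards: writes block every start, reads block
    every start under A and only writes under I. *)
Lemma conc_start_Sw C a r t d : is_sr a || is_sw a -> reg a = Some r ->
  ~~ conc C a (Sw t r d).
Proof.
by move=> sa ra; case: C; rewrite /= /concA /concI /concS sa ra /= eqxx /= !andbF.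
Qed.

Lemma concA_Sr a r t : is_sr a || is_sw a -> reg a = Some r ->
  ~~ concA a (Sr t r).
Proof.
move=> /orP[] sa ra; rewrite /= /concA /concI /concS sa ra /= eqxx /= !andbF //.
Qed.

Lemma concI_Sr a r t : is_sw a -> reg a = Some r -> ~~ concI a (Sr t r).
Proof. by move=> sa ra; rewrite /= /concI /concS sa ra /= eqxx /= !andbF. Qed.

Section VariantToAtomic.
Variables (th : nat -> forall t, state (T t)).
Variables (q : nat -> forall r, status r) (ac : nat -> option (act G)).
Variable C : criterion.
Hypotheses (hr : mrun (variant_rg C) (variant_wg C) th q ac)
           (hj : mjust (variant_rg C) (variant_wg C) th q ac C).

Lemma idle_atomic_guard n t r : idle q n t -> atomic_guard (q n r) t.
Proof. by move/forallP/(_ r). Qed.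

Lemma variant_run_atomic : mrun atomic_guard atomic_guard th q ac.
Proof.
by apply: mrun_guard hr _ _ => [n t r|n t r d] i _; apply: idle_atomic_guard.
Qed.

(* If nothing interferes with a start action enabled in the atomic model, then
   the operations that block it in the variant finish and are not replaced. *)
Lemma variant_just_atomic : mjust atomic_guard atomic_guard th q ac C.
Proof.
move=> n a nB en; apply: contrapT => hno.
have {}hno m b : n <= m -> ac m = Some b -> conc C a b.
  move=> nm em; apply: contrapT => /negP cb; apply: hno; by exists m, b.
(* At such an [m], justness of the variant run yields the interfering action that was assumed
   absent. *)
suff [m nm em] : exists2 m, n <= m & menabled (variant_rg C) (variant_wg C) th q m a.
  have [k [b [mk ek cb]]] := hj nB em.
  by have := hno k b (leq_trans nm mk) ek; rewrite (negbTE cb).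
have [sa|nsa] := boolP (is_sr a || is_sw a); last first.
  exists n => //; case: en => en1 en2; split=> // r /en2[s' tr]; exists s'.
  by apply: register_trans_guard tr _ _ => [t ea|t d ea]; rewrite ea in nsa.
(* An action of the same thread always interferes, so the thread of [a] stays put from [n] on. *)
have hs m : n <= m -> same th q n m (thr a).
  move=> nm; apply: (same_many variant_run_atomic nm) => k b /andP[nk _] ek eb.
  by have := hno k b nk ek; rewrite (negbTE (conc_thr _ (esym eb))).
have la : ~~ register_local a by case: a sa {nB en hno hs}.
have ia : idle_act a by case: a sa {nB en hno hs la}.
have idl m : n <= m -> idle q m (thr a).
  move=> nm; rewrite (same_idle (hs m nm)).
  exact: enabled_idle variant_run_atomic _ _ _ ia (en.1 la).
have [r ra] : exists r, reg a = Some r.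
  by case: a sa {nB en hno hs la ia idl} => // t r *; exists r.
have noSw m t d : n <= m -> ac m <> Some (Sw t r d).
  move=> nm em; have := hno _ _ nm em.
  by rewrite (negbTE (conc_start_Sw _ _ _ sa ra)).
(* These are the cases in which the variant guard requires all of [rds] to be empty. *)
have noSr m t : (C = CritA \/ C = CritI /\ is_sw a) ->
    n <= m -> ac m <> Some (Sr t r).
  move=> hC nm em; have := hno _ _ nm em.
  case: hC => [->|[-> sw]] /=; first by rewrite (negbTE (concA_Sr _ sa ra)).
  by rewrite (negbTE (concI_Sr _ sw ra)).
have [wsub [m nm wm]] := drain_writes hr hj noSw.
have wk k : m <= k -> wrts (q k r) = set0.
  move=> /subnK <-; elim: (k - m) => // d IH.
  by rewrite addSn; apply/eqP; rewrite -subset0 -IH wsub //; lia.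
have [k mk gk] : exists2 k, m <= k & wrts (q k r) = set0 /\
    (C = CritA \/ C = CritI /\ is_sw a -> rds (q k r) = set0).
  have [hC|hC] := pselect (C = CritA \/ C = CritI /\ is_sw a).
    have [|k mk rk] := @drain_reads _ _ _ _ _ _ hr hj m r.
      by move=> i t mi; apply: noSr => //; lia.
    by exists k => //; split=> //; apply: wk.
  by exists m.
have nk : n <= k by lia.
exists k => //; split.
  by move=> _; have [-> _] := hs k nk; apply: en.1.
move=> r'; rewrite ra => -[<-] {r'}; case: gk => gw gr.
have [hrd hwr] := idleP r (idl k nk).
case: a sa ra hrd hwr gr {nB en hno hs la ia idl noSr} => // t r0 => [|d] _ /= -[e];
  subst r0 => hrd hwr gr.
- eexists; constructor; rewrite /variant_rg.
  case: C gr => gr; rewrite ?hrd ?gw ?eqxx // gr; last by left.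
  by rewrite setU0 eqxx.
- eexists; constructor; rewrite /variant_wg.
  case: C gr => gr; rewrite ?gw ?setU0 ?gr ?eqxx //; first by left.
  by right.
Qed.

End VariantToAtomic.

(** * From the atomic registers to the variants *)

(** Makes room for a block of three actions at each step of the given run. *)
Definition weave X (f g h : nat -> X) i :=
  let n := i %/ 3 in match i %% 3 with 0 => f n | 1 => g n | _ => h n end.

Lemma weave0 X (f g h : nat -> X) n : weave f g h (n * 3) = f n.
Proof. by rewrite /weave mulnK // modnMl. Qed.

Lemma weave1 X (f g h : nat -> X) n : weave f g h (n * 3).+1 = g n.
Proof. by rewrite /weave -addn1 divnMDl // modnMDl addn0. Qed.

Lemma weave2 X (f g h : nat -> X) n : weave f g h (n * 3).+2 = h n.
Proof. by rewrite /weave -addn2 divnMDl // modnMDl addn0. Qed.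

Lemma weave3 X (f g h : nat -> X) n : weave f g h (n * 3).+3 = f n.+1.
Proof. exact: (weave0 f g h n.+1). Qed.

Definition weaveE := (weave0, weave1, weave2, weave3).

Lemma third_ind (P : nat -> Prop) :
  (forall n, [/\ P (n * 3), P (n * 3).+1 & P (n * 3).+2]) -> forall i, P i.
Proof.
move=> h i; rewrite (divn_eq i 3); have [h0 h1 h2] := h (i %/ 3).
have : i %% 3 < 3 by rewrite ltn_mod.
by case: (i %% 3) => [|[|[|]]] // _; rewrite ?addn0 ?addn1 ?addn2.
Qed.

Section Serialization.
Variables (th : nat -> forall t, state (T t)).
Variables (q : nat -> forall r, status r) (ac : nat -> option (act G)).
Variable C : criterion.
Hypotheses (hr : mrun atomic_guard atomic_guard th q ac)
           (hj : mjust atomic_guard atomic_guard th q ac C).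

Let idl := eventually_idle hr hj.

Definition next_idle n t := th (ex_minn (idl n t)) t.

Fixpoint last_idle n t := if n is m.+1 then
    if idle q n t then th n t else last_idle m t
  else th 0 t.

(* A thread whose operation is not ordered yet is set back to before the
   operation, and one whose operation is ordered is advanced beyond it. *)
Definition serial_thr n t :=
  if [exists r, t \in pend (q n r)] then last_idle n t else next_idle n t.

Lemma next_idle_idle n t : idle q n t -> next_idle n t = th n t.
Proof.
move=> i; rewrite /next_idle; case: ex_minnP => m /andP[nm im] /(_ n).
by rewrite leqnn i => /(_ isT) mn; congr (th _ t); lia.
Qed.

Lemma next_idleS n t : ~~ idle q n t -> next_idle n.+1 t = next_idle n t.
Proof.
move=> i; rewrite /next_idle.
case: ex_minnP => m /andP[nm im] minm; case: ex_minnP => k /andP[nk ik] mink.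
congr (th _ t).
have kn : n <> k by move=> e; rewrite -e (negbTE i) in ik.
have := minm k; rewrite ik andbT => /(_ _); have := mink m; rewrite im andbT.
lia.
Qed.

Lemma last_idle_idle n t : idle q n t -> last_idle n t = th n t.
Proof. by case: n => //= n ->. Qed.

Lemma idle_not_pending n t : idle q n t -> [exists r, t \in pend (q n r)] = false.
Proof. by move=> i; apply/existsP => -[r]; rewrite (idle_pend hr). Qed.

Lemma serial_thr_idle n t : idle q n t -> serial_thr n t = th n t.
Proof. by move=> i; rewrite /serial_thr idle_not_pending // next_idle_idle. Qed.

Lemma serial_thr_pend n t r : t \in pend (q n r) -> serial_thr n t = last_idle n t.
Proof. by rewrite /serial_thr => p; case: existsP => // -[]; exists r. Qed.

Lemma serial_thr_post n t r : busy q n t r -> t \notin pend (q n r) ->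
  serial_thr n t = next_idle n t.
Proof.
move=> b p; rewrite /serial_thr; case: existsP => // -[r' p'].
by rewrite (busy_inj hr b (run_pend hr p')) p' in p.
Qed.

Lemma busy_not_idle n t r : busy q n t r -> ~~ idle q n t.
Proof. by move=> b; rewrite negb_forall; apply/existsP; exists r; rewrite negbK. Qed.

Lemma serial_thr_same n t :
  (forall a, ac n = Some a -> thr a <> t) -> serial_thr n.+1 t = serial_thr n t.
Proof.
move=> h; have s := same_step hr h; case: (s) => e1 e2.
have ei := same_idle s.
rewrite /serial_thr.
have -> : [exists r, t \in pend (q n.+1 r)] = [exists r, t \in pend (q n r)].
  by apply: eq_existsb => r; case: (e2 r).
case: existsP => [[r p]|_] /=.
  by rewrite ei (negbTE (busy_not_idle (run_pend hr p))).
have [i|ni] := boolP (idle q n t); last by rewrite next_idleS.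
by rewrite !next_idle_idle ?ei.
Qed.

Lemma start_idle n a : ac n = Some a -> is_sr a || is_sw a -> idle q n (thr a).
Proof.
move=> ea sa; apply: (enabled_idle hr (a := a)); first by case: a sa {ea}.
by apply: (run_enabled hr ea); case: a sa {ea}.
Qed.

Lemma start_pend n a : ac n = Some a -> is_sr a || is_sw a ->
  exists r, [/\ reg a = Some r, thr a \in pend (q n.+1 r)
    & (thr a \in rds (q n.+1 r)) = is_sr a].
Proof.
move=> ea sa.
have ia := start_idle ea sa.
case: a ea sa ia => // t r => [|d] ea _ ia; exists r; split=> //.
- have [_ _ ->] := register_transP (run_reg hr (r := r) ea erefl).
  by rewrite /= !inE eqxx.
- have [_ _ ->] := register_transP (run_reg hr (r := r) ea erefl).
  by rewrite /= !inE eqxx.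
- have [_ _ [d' _ ->]] := register_transP (run_reg hr (r := r) ea erefl).
  by rewrite /= !inE eqxx.
- have [_ _ [d' _ ->]] := register_transP (run_reg hr (r := r) ea erefl).
  by have [-> _] := idleP r ia.
Qed.

(** The start makes the thread pending, and it is set back to the idle state it has just left. *)
Lemma serial_thr_start n a : ac n = Some a -> is_sr a || is_sw a ->
  serial_thr n.+1 (thr a) = serial_thr n (thr a).
Proof.
move=> ea sa; have i := start_idle ea sa.
have [r [_ p _]] := start_pend ea sa.
rewrite (serial_thr_pend p) serial_thr_idle //=.
by rewrite (negbTE (busy_not_idle (run_pend hr p))) last_idle_idle.
Qed.

Definition is_finish a := match a with Fr _ _ _ | Fw _ _ => true | _ => false end.

Lemma finishP n a : ac n = Some a -> is_finish a ->
  exists r, [/\ busy q n (thr a) r, thr a \notin pend (q n r)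
    & a = finish_act q n (thr a) r].
Proof.
move=> ea fa; case er: (reg a) => [r|]; last by case: a fa er {ea}.
have [h1 h2] : busy q n (thr a) r /\ thr a \notin pend (q n r).
  have := register_transP (run_reg hr ea er); rewrite /busy.
  case: a fa er {ea} => // t r0 => [d|] _ /= _ [_]; rewrite !inE => /andP[-> ->] //.
  by rewrite orbT.
by exists r; split=> //; apply: (post_act hr).
Qed.

(** The finish leads to the idle state to which the thread was already advanced when its operation
    was ordered. *)
Lemma serial_thr_finish n a : ac n = Some a -> is_finish a ->
  serial_thr n.+1 (thr a) = serial_thr n (thr a).
Proof.
move=> ea /(finishP ea)[r [b p e]].
have ea' : ac n = Some (finish_act q n (thr a) r) by rewrite -e.
have i := finish_idle hr b ea'.
rewrite (serial_thr_post b p) -next_idleS ?(busy_not_idle b) //.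
by rewrite serial_thr_idle // next_idle_idle.
Qed.

Lemma idle_step_idle n t : idle q n t ->
  (forall a, ac n = Some a -> thr a = t -> ~~ (is_sr a || is_sw a)) ->
  idle q n.+1 t.
Proof.
move=> i h.
have [[a [ea et]]|h'] := pselect (exists a, ac n = Some a /\ thr a = t); last first.
  rewrite (same_idle (same_step hr _)) // => a ea et; apply: h'; by exists a.
have := h a ea et; rewrite -et in i *.
have := idle_idle_act hr ea i.
case: a ea {h et} i => //= t0 l ea i _ _; apply/forallP => r.
by rewrite /busy (run_reg_id hr) ?(forallP i) // => b; rewrite ea => -[<-].
Qed.

(** Between a start and its order the thread does nothing, so its current state is the target of the
    start; the value written is still in [rcd]. *)
Lemma trans_last_idle n t r : t \in pend (q n r) ->
  (t \in rds (q n r) -> trans (last_idle n t) (Sr t r) (th n t)) /\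
  (t \in wrts (q n r) -> trans (last_idle n t) (Sw t r (rcd (q n r) t)) (th n t)).
Proof.
elim: n => [|n IH]; first by rewrite (run_reg0 hr) inE.
move=> p; rewrite /= (negbTE (busy_not_idle (run_pend hr p))).
have [[a [ea et]]|h] := pselect (exists a, ac n = Some a /\ thr a = t); last first.
  have [|-> /(_ r) [e1 e2 e3 e4]] := same_step hr (n := n) (t := t).
    by move=> a ea et; apply: h; exists a.
  by rewrite e1 e2 e4; apply: IH; rewrite -e3.
have [i|ni] := boolP (idle q n t).
  have [sa|nsa] := boolP (is_sr a || is_sw a); last first.
    (* Without a start an idle thread stays idle, yet it is pending at [n.+1]. *)
    have := idle_step_idle i; rewrite (negbTE (busy_not_idle (run_pend hr p))).
    by case/(_ _)/Bool.diff_false_true => b; rewrite ea => -[<-].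
  have [r' [ra p' e]] := start_pend ea sa.
  rewrite et in p' e.
  have er := busy_inj hr (run_pend hr p) (run_pend hr p').
  subst r'; rewrite last_idle_idle // e.
  have tr := run_thr hr ea.
  case: a ea sa ra et tr e => // t0 r0 => [|d] ea _ /= [er] et tr e;
    subst r0 t0; split=> [hrd|hwr].
  - exact: tr.
  - by have := read_write_disjoint hr e hwr.
  - by [].
  - have [_ _ [d' ed e']] := register_transP (run_reg hr (r := r) ea erefl).
    have -> : rcd (q n.+1 r) t = d' by rewrite e' /= ffunE eqxx.
    by rewrite -ed; apply: tr.
(* A busy thread can only order, which clears its pending mark, or finish, which makes it idle;
   neither leaves it pending at [n.+1]. *)
exfalso.
have [r' b] := busyP ni.
rewrite -et in b p.
have [p'|p'] := boolP (thr a \in pend (q n r')).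
  have e := pend_act hr ea p'; have ea' := ea; rewrite e in ea'.
  have [_ _ np] := order_pend hr ea'.
  have [er|nr] := eqVneq r r'; first by rewrite er (negbTE np) in p.
  move: p; rewrite (run_reg_id hr).
    by move/(run_pend hr) => b'; rewrite (busy_inj hr b' b) eqxx in nr.
  move=> c; rewrite ea' => -[<-]; rewrite /order_act.
  by case: ifP => _ [er]; rewrite er eqxx in nr.
have e := post_act hr ea b p'; have ea' := ea; rewrite e in ea'.
have i := finish_idle hr b ea'.
by rewrite (idle_pend hr) in p.
Qed.

Lemma trans_next_idle n t r : busy q n t r -> t \notin pend (q n r) ->
  trans (th n t) (finish_act q n t r) (next_idle n t).
Proof.
rewrite /next_idle; case: ex_minnP => m /andP[nm im] minm b p.
(* The first idle time [m] stays fixed while [n] moves up to it, so its minimality is restated in a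
   form that the induction on [m - n] preserves. *)
have nk k : n <= k < m -> ~~ idle q k t.
  move=> /andP[nk km]; apply/negP => ik; have := minm k.
  by rewrite nk ik => /(_ isT); lia.
have [c hc] : exists c, m - n <= c by exists (m - n).
have lt k : k <= m -> busy q k t r -> k < m.
  move=> km bk; rewrite ltn_neqAle km andbT; apply/eqP => e.
  by have := busy_not_idle bk; rewrite e im.
elim: c n hc nm b p nk {minm} => [|c IH] n hc nm b p nk;
  have {}lt := lt n nm b; first by lia.
have [[a [ea et]]|h] := pselect (exists a, ac n = Some a /\ thr a = t).
  have e : a = finish_act q n t r by rewrite -et; apply: (post_act hr); rewrite ?et.
  have i : idle q n.+1 t by apply: (finish_idle hr b); rewrite -e.
  have -> : m = n.+1.
    apply/eqP; rewrite eqn_leq lt andbT leqNgt; apply/negP => ltm.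
    by have := nk n.+1; rewrite i ltm leqnSn => /(_ isT).
  rewrite -e -et; apply: (run_thr hr ea).
  by rewrite e /finish_act; case: ifP.
have s : same th q n n.+1 t.
  by apply: (same_step hr) => a ea et; apply: h; exists a.
have [e /(_ r) [e1 e2 e3 e4]] := s.
rewrite -e.
have -> : finish_act q n t r = finish_act q n.+1 t r by rewrite /finish_act e1 e4.
apply: IH => //; first by lia.
- by rewrite /busy !inE e1 e2 -in_setU.
- by rewrite e3.
- by move=> k hk; apply: nk; lia.
Qed.

(** The value written comes from the original status, where it has been recorded since the original
    start. *)
Definition reg_start n r (s : status r) : status r := match ac n with
  | Some (Or t r') => if r' == r then usr s t else s
  | Some (Ow t r') => if r' == r then usw s t (rcd (q n r) t) else s
  | _ => s end.

Definition reg_order n r (s : status r) : status r := match ac n with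
  | Some (Or t r') => if r' == r then uor s t else s
  | Some (Ow t r') => if r' == r then uow s t (rcd s t) else s
  | _ => s end.

Definition reg_finish n r (s : status r) : status r := match ac n with
  | Some (Or t r') => if r' == r then ufr s t else s
  | Some (Ow t r') => if r' == r then ufw s t (stor s) else s
  | _ => s end.

Fixpoint serial_reg n r : status r :=
  if n is m.+1 then reg_finish m (reg_order m (reg_start m (serial_reg m r)))
  else init_status r.

(** Thread-local actions occupy the first slot of their triple; an original start or finish leaves
    all three slots idle. *)
Definition act_start n := match ac n with
  | Some (Or t r) => Some (Sr t r)
  | Some (Ow t r) => Some (Sw t r (rcd (q n r) t))
  | Some (Loc t l) => Some (Loc t l)
  | _ => None end.

Definition act_order n := match ac n with
  | Some (Or t r) => Some (Or t r)
  | Some (Ow t r) => Some (Ow t r)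
  | _ => None end.

(** A read returns the storage at its order, which is what [uor] records. *)
Definition act_finish n := match ac n with
  | Some (Or t r) => Some (Fr t r (stor (q n r)))
  | Some (Ow t r) => Some (Fw t r)
  | _ => None end.

(** Only the owner of a block waits in between. Any other thread is already in its state after the
    triple, since a thread-local action is done in the first slot. *)
Definition thr_mid n t := match ac n with
  | Some (Or t' _) | Some (Ow t' _) =>
      if t' == t then th n t else serial_thr n.+1 t
  | _ => serial_thr n.+1 t end.

Definition free_status r (s : status r) :=
  [/\ rds s = set0, wrts s = set0 & pend s = set0].

(** In the original only [Ow] changes [stor], as [Fw] writes back the current storage. A whole block
    has the same effect on [stor] and empties the three sets again. *)
Lemma serial_reg_free n r :
  free_status (serial_reg n r) /\ stor (serial_reg n r) = stor (q n r).
Proof.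
elim: n => [|n [[IH1 IH2 IH3] IH4]] /=; first by rewrite (run_reg0 hr).
rewrite /reg_finish /reg_order /reg_start.
have [[a [ea ra]]|h] := pselect (exists a, ac n = Some a /\ reg a = Some r);
  last first.
  rewrite (run_reg_id hr); last by move=> a ea ra; apply: h; exists a.
  case ea: (ac n) => [a|] //.
  case: a ea => // t r' ea; case: eqP => // er;
    by case: h; exists (if ac n is Some a then a else Or t r); rewrite ea /= er.
have := register_transP (run_reg hr ea ra).
rewrite ea; case: a ra {ea} => //= t r'.
- by move=> _ [_ _ ->].
- by move=> d _ [_ _ ->].
- by move=> d _ [_ _ [d' _ ->]].
- by move=> _ [_ _ ->].
- move=> [->] [_ _ ->]; rewrite eqxx /free_status /= IH1 IH2 IH3 IH4.
  by split=> //; split; apply/setP => x; rewrite !inE; case: (x == t).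
- move=> [->] [_ _ ->]; rewrite eqxx /free_status /= IH1 IH2 IH3 ffunE eqxx.
  by split=> //; split; apply/setP => x; rewrite !inE; case: (x == t).
Qed.

Lemma order_actP n a : ac n = Some a -> register_local a ->
  exists r, [/\ a = order_act q n (thr a) r, thr a \in pend (q n r)
    & (thr a \in wrts (q n r)) = ~~ (thr a \in rds (q n r))].
Proof.
move=> ea la; case er: (reg a) => [r|]; last by case: a la er {ea}.
have p : thr a \in pend (q n r).
  have := register_transP (run_reg hr ea er).
  by case: a la er {ea} => // t r0 _ /= _ [_]; rewrite inE => /andP[].
exists r; split=> //; first exact: (pend_act hr).
have := run_pend hr p; rewrite /busy inE.
case e: (_ \in rds _) => /=; last by [].
by move=> _; apply/negbTE/negP => /(read_write_disjoint hr e).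
Qed.

(** The two thread moves of a block, joined at the waiting state [th n]: the first is taken from the
    past of the run, the second from its future. *)
Lemma serial_order n a : ac n = Some a -> register_local a ->
  exists r, [/\ a = order_act q n (thr a) r,
    trans (serial_thr n (thr a))
      (if thr a \in rds (q n r) then Sr (thr a) r
       else Sw (thr a) r (rcd (q n r) (thr a))) (th n (thr a))
  & trans (th n (thr a))
      (if thr a \in rds (q n r) then Fr (thr a) r (stor (q n r))
       else Fw (thr a) r) (serial_thr n.+1 (thr a))].
Proof.
move=> ea la; have [r [e p w]] := order_actP ea la; exists r; split=> //.
  rewrite (serial_thr_pend p); have [h1 h2] := trans_last_idle p.
  by case: ifP w => h /= w; [apply: h1|apply: h2].
have ea' := ea; rewrite e in ea'.
have [o1 o2 o3] := order_pend hr ea'.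
have b : busy q n.+1 (thr a) r.
  by rewrite /busy inE o1 o2 -in_setU; apply: (run_pend hr).
have -> : th n (thr a) = th n.+1 (thr a).
  by rewrite (run_thr_id hr) // => c; rewrite ea => -[<-].
rewrite (serial_thr_post b o3).
have := trans_next_idle b o3; rewrite /finish_act o1.
case: ifP => // h; rewrite h in w.
have er : reg a = Some r by rewrite e /order_act h.
have := register_transP (run_reg hr ea er).
rewrite {1}e /order_act h => -[_ _ ->] /=.
by rewrite ffunE eqxx.
Qed.

Lemma thr_mid_other n t : (forall a, ac n = Some a -> thr a <> t) ->
  thr_mid n t = serial_thr n t.
Proof.
move=> h; rewrite /thr_mid -(serial_thr_same h).
case ea: (ac n) => [a|] //; have := h a ea.
by case: a {ea} => // t' r /= nt; case: eqP.
Qed.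

Lemma serial_thr_silent n t a : ac n = Some a -> act_start n = None ->
  serial_thr n.+1 t = serial_thr n t.
Proof.
move=> ea; have [et|nt] := eqVneq (thr a) t; last first.
  by move=> _; apply: serial_thr_same => b; rewrite ea => -[<-]; apply/eqP.
rewrite -et /act_start ea.
have := @serial_thr_start n a ea; have := @serial_thr_finish n a ea.
by case: a {ea et} => // *; auto.
Qed.

(** * The serialized run and its trace *)

Variables rg wg : guard.
Hypothesis guard_free : forall r (s : status r) t,
  rds s = set0 -> wrts s = set0 -> @rg r s t /\ @wg r s t.

Definition ser_thr i t :=
  weave (serial_thr^~ t) (thr_mid^~ t) (thr_mid^~ t) i.
Definition ser_reg i r :=
  weave (serial_reg^~ r) (fun n => reg_start n (serial_reg n r))
    (fun n => reg_order n (reg_start n (serial_reg n r))) i.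
Definition ser_act := weave act_start act_order act_finish.

Lemma serial_loc n t l : ac n = Some (Loc t l) ->
  serial_thr n t = th n t /\ serial_thr n.+1 t = th n.+1 t.
Proof.
move=> ea.
have i : idle q n t.
  by apply: (enabled_idle hr (a := Loc t l)) => //; apply: (run_enabled hr ea).
split; first exact: serial_thr_idle.
apply: serial_thr_idle; apply: (idle_step_idle i) => a.
by rewrite ea => -[<-].
Qed.

Lemma serial_run : mrun rg wg ser_thr ser_reg ser_act.
Proof.
split.
- move=> t; rewrite /ser_thr (weave0 _ _ _ 0) serial_thr_idle ?(run_thr0 hr) //.
  by apply/forallP => r; rewrite /busy (run_reg0 hr) !inE.
- by move=> r; rewrite /ser_reg (weave0 _ _ _ 0).
- elim/third_ind => n; split=> a; rewrite /ser_act /ser_thr !weaveE.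
  + rewrite /act_start; case ea: (ac n) => [c|] //.
    have := @serial_order n c ea.
    case: c ea => // t r => [ea /(_ isT)|ea /(_ isT)|ea _] => [||[<-]] /=.
    * move=> [r' [e tr _]] [<-] _ /=; rewrite /thr_mid ea eqxx.
      by move: e tr; rewrite /order_act; case: ifP => // _ [->].
    * move=> [r' [e tr _]] [<-] _ /=; rewrite /thr_mid ea eqxx.
      by move: e tr; rewrite /order_act; case: ifP => // _ [->].
    * move=> _; rewrite /thr_mid ea; have [-> ->] := serial_loc ea.
      exact: (run_thr hr ea).
  + by rewrite /act_order; case: (ac n) => [[]|] // t r [<-].
  + rewrite /act_finish; case ea: (ac n) => [c|] //.
    have := @serial_order n c ea.
    case: c ea => // t r ea /(_ isT) [r' [e _ tr]] [<-] _ /=;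
      rewrite /thr_mid ea eqxx;
      by move: e tr; rewrite /order_act /=; case: ifP => // _ [->].
- elim/third_ind => n; split=> t h; rewrite /ser_thr !weaveE //.
  + move: h; rewrite /ser_act weaveE => h.
    case ea: (ac n) => [a|]; last by apply: thr_mid_other => b; rewrite ea.
    have [et|nt] := eqVneq (thr a) t; last first.
      by apply: thr_mid_other => b; rewrite ea => -[<-]; apply/eqP.
    case es: (act_start n) => [b|]; last first.
      rewrite -(serial_thr_silent t ea es) /thr_mid.
      by move: es; rewrite /act_start ea; case: a {ea et}.
    have := h b es; move: es; rewrite /act_start ea.
    by case: a et {ea} => //= t0 r0 e [<-] /(_ e).
  + move: h; rewrite /ser_act weaveE /act_finish /thr_mid => h.
    case: (ac n) h => [a|] //; case: a => // t0 r0 h; case: eqP => // e;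
      by have := h _ erefl e.
- elim/third_ind => n; split=> a r; rewrite /ser_act /ser_reg !weaveE;
    have [[f1 f2 f3] f4] := serial_reg_free n r.
  + rewrite /act_start /reg_start; case: (ac n) => [c|] //.
    case: c => // t r0 [<-] //= [e]; subst r0; rewrite eqxx; constructor;
      by case: (guard_free t f1 f2).
  + rewrite /act_order /reg_start /reg_order; case: (ac n) => [c|] //.
    case: c => // t r0 [<-] //= [e]; subst r0; rewrite eqxx; constructor;
      by rewrite /= !inE eqxx.
  + rewrite /act_finish /= /reg_start /reg_order /reg_finish.
    case: (ac n) => [c|] //.
    case: c => // t r0 [<-] //= [e]; subst r0; rewrite eqxx.
    (* [step_fr] returns the recorded value, so the storage is first rewritten into that form. *)
    * have e : stor (q n r) = rcd (uor (usr (serial_reg n r) t) t) t.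
        by rewrite /= ffunE eqxx f4.
      by rewrite e; constructor; rewrite /= !inE eqxx.
    * by constructor; rewrite /= !inE eqxx.
- elim/third_ind => n; split=> r; rewrite /ser_act /ser_reg !weaveE /=.
  + rewrite /act_start /reg_start; case: (ac n) => [c|] //.
    by case: c => // t r0 h; case: eqP => // e; have := h _ erefl; rewrite /= e.
  + rewrite /act_order /reg_order; case: (ac n) => [c|] //.
    by case: c => // t r0 h; case: eqP => // e; have := h _ erefl; rewrite /= e.
  + rewrite /act_finish /reg_finish; case: (ac n) => [c|] //.
    by case: c => // t r0 h; case: eqP => // e; have := h _ erefl; rewrite /= e.
Qed.

(** Visible actions are thread-local and so live in first slots; visible counts therefore agree at
    multiples of three. *)
Lemma serial_collapses w : collapses (owhen (@visible G) ac) w ->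
  collapses (owhen (@visible G) ser_act) w.
Proof.
set v := @visible G => hw.
have vis a : v a -> exists t l, a = Loc t l.
  by rewrite /v /visible /= inE => /orP[] /imsetP[t _ ->]; eexists; eexists.
have nvis a : (forall t l, a <> Loc t l) -> v a = false.
  by move=> h; apply/negP => /vis[t [l /h]].
have e0 n : owhen v ser_act (n * 3) = owhen v ac n.
  rewrite /owhen /ser_act weaveE /act_start.
  by case: (ac n) => [[]|] // *; rewrite ?nvis.
have e1 n : owhen v ser_act (n * 3).+1 = None.
  rewrite /owhen /ser_act weaveE /act_order.
  by case: (ac n) => [[]|] // *; rewrite ?nvis.
have e2 n : owhen v ser_act (n * 3).+2 = None.
  rewrite /owhen /ser_act weaveE /act_finish.
  by case: (ac n) => [[]|] // *; rewrite ?nvis.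
have ecnt n : cnt (owhen v ser_act) (n * 3) = cnt (owhen v ac) n.
  elim: n => // n IH; rewrite mulSn !addSn add0n !cntS e2 e1 e0 IH.
  by rewrite !addn0.
move=> k x; rewrite (hw k x); split=> -[].
  by move=> n en <-; exists (n * 3); rewrite ?e0 ?ecnt.
elim/third_ind => n; split; rewrite ?e0 ?e1 ?e2 // ecnt => en <-.
by exists n.
Qed.

(** * Justness of the serialized run *)

Lemma pend_serial n t r : t \in pend (q n r) -> exists m d,
  n <= m /\ ser_act (m * 3) =
    Some (if t \in rds (q n r) then Sr t r else Sw t r d).
Proof.
move=> p; have [m [nm em _]] := eventually_order hr hj p.
(* The block is placed where the operation is ordered; interference ignores the value, see
   [conc_Sw_value]. *)
exists m, (rcd (q m r) t); split=> //.
by rewrite /ser_act weaveE /act_start em /order_act; case: ifP.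
Qed.

Lemma pend_interferes n t r a : t \in pend (q n r) -> thr a = t ->
  exists i b, [/\ n * 3 <= i, ser_act i = Some b & ~~ conc C a b].
Proof.
move=> p et; have [m [d [nm em]]] := pend_serial p.
exists (m * 3); eexists; split; first by rewrite leq_mul2r.
  exact: em.
by apply: conc_thr; rewrite et; case: ifP.
Qed.

Lemma conc_other_start a b : ~~ conc C a b -> thr a <> thr b ->
  is_sr b || is_sw b.
Proof.
move=> h /eqP ne; apply/negPn/negP; rewrite negb_or => /andP[/negbTE nr /negbTE nw].
by move: h; case: C; rewrite /= /concA /concI /concS /concT ne ?nr nw /= ?andbF.
Qed.

Lemma conc_Sw_value a t r d d' : conc C a (Sw t r d) = conc C a (Sw t r d').
Proof. by case: C. Qed.

(** Idleness is all that the atomic guard asks, so [a] is enabled in the original run and some [b]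
    interferes. It has to survive serialization: a start reappears in a later block, a thread-local
    action stays. *)
Lemma idle_just n a : a \notin nc_actions G -> idle_act a -> idle q n (thr a) ->
  enabled (th n (thr a)) a ->
  exists i b, [/\ n * 3 <= i, ser_act i = Some b & ~~ conc C a b].
Proof.
move=> nB ia i en.
have [|m [b [nm em cb]]] := hj (n := n) nB.
  split=> // r ra; case: a ra ia i {nB en} => // t r' => [|d] /= [e] _ i;
    subst r'; eexists; constructor; exact: idle_atomic_guard i.
have [eb|nb] := pselect (thr a = thr b); last first.
  have [r [rb p e]] := start_pend em (conc_other_start cb nb).
  have [k [d [mk]]] := pend_serial p; rewrite e => ek.
  exists (k * 3); eexists; split; [|exact: ek|]; first by rewrite leq_mul2r; lia.
  have sb := conc_other_start cb nb.
  move: cb rb sb; case: b {em nb p e ek} => //=.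
    by move=> t r' + [<-].
  by move=> t r' d' + [e]; subst r'; rewrite (conc_Sw_value _ _ _ d').
(* [b] itself may be a deleted finish; the first action of an idle thread is a start or
   thread-local. *)
have [k [c [/andP[nk _] ek ec sk]]] := first_action hr nm em.
rewrite -eb in ec sk.
have ik : idle q k (thr c) by rewrite ec (same_idle sk).
have ic := idle_idle_act hr ek ik.
have [sc|nsc] := boolP (is_sr c || is_sw c).
  have [r [_ p _]] := start_pend ek sc.
  have [j [d [kj ej cd]]] := pend_interferes p (esym ec).
  by exists j, d; split=> //; lia.
exists (k * 3), c; rewrite leq_mul2r nk orbT conc_thr //; split=> //.
by rewrite /ser_act weaveE /act_start ek; case: c ic nsc {ek ec ik}.
Qed.

(** A thread set back still has its block ahead; an advanced one is in the state of a later idle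
    time, where [idle_just] applies. *)
Lemma serial_thr_just n a : a \notin nc_actions G -> idle_act a ->
  enabled (serial_thr n (thr a)) a ->
  exists i b, [/\ n * 3 <= i, ser_act i = Some b & ~~ conc C a b].
Proof.
move=> nB ia; rewrite /serial_thr; case: existsP => [[r p] _|_].
  exact: pend_interferes p erefl.
rewrite /next_idle; case: ex_minnP => m /andP[nm im] _ en.
have [i [b [mi ei cb]]] := idle_just nB ia im en.
by exists i, b; split=> //; lia.
Qed.

Lemma menabled_idle_act th' q' i a :
  menabled rg wg th' q' i a ->
  (forall r, thr a \notin rds (q' i r) :|: wrts (q' i r)) -> idle_act a.
Proof.
case=> _ en h; case er: (reg a) => [r|]; last by case: a er {en h}.
have [s' /register_transP] := en r er; have := h r; rewrite inE.
by case: a {en h er} => //= t r0 => [d|||] hn [_];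
  rewrite inE => /andP[]; move: hn; case: (t \in rds _); case: (t \in wrts _).
Qed.

Lemma serial_just : mjust rg wg ser_thr ser_reg ser_act C.
Proof.
have away n t : (forall c, ac n = Some c -> register_local c -> thr c <> t) ->
    thr_mid n t = serial_thr n.+1 t /\ forall r,
    t \notin rds (reg_start n (serial_reg n r)) :|:
              wrts (reg_start n (serial_reg n r)).
  rewrite /thr_mid /reg_start => h; split.
    case: (ac n) h => [c|] //; case: c => // t' r h; case: eqP => // e;
      by have := h _ erefl erefl.
  move=> r; have [[f1 f2 _] _] := serial_reg_free n r.
  case: (ac n) h => [c|] => [|_]; last by rewrite f1 f2 !inE.
  by case: c => [t' r'|t' r' d|t' r' d|t' r'|t' r'|t' r'|t' l] h;
    rewrite ?f1 ?f2 ?inE //; case: eqP => _; rewrite /= ?f1 ?f2 !inE ?orbF //;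
    apply/eqP => e; have := h _ erefl erefl; rewrite /= e.
have ordE n r (s : status r) : (rds (reg_order n s) = rds s) *
    (wrts (reg_order n s) = wrts s).
  rewrite /reg_order; case: (ac n) => [c|] //.
  by case: c => // t r'; case: eqP.
have here n a : (exists c, [/\ ac n = Some c, register_local c & thr c = thr a])
    \/ (forall c, ac n = Some c -> register_local c -> thr c <> thr a).
  case: (pselect (exists c, [/\ ac n = Some c, register_local c & thr c = thr a])).
    by left.
  by move=> h; right=> c ec lc tc; apply: h; exists c.
elim/third_ind => n; split=> a nB en.
- apply: serial_thr_just => //.
    apply: menabled_idle_act en _ => r; rewrite /ser_reg weaveE.
    by have [[-> -> _] _] := serial_reg_free n r; rewrite !inE.
  have [en1 _] := en; move: en1; rewrite /ser_thr weaveE; apply.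
  have : idle_act a.
    apply: menabled_idle_act en _ => r; rewrite /ser_reg weaveE.
    by have [[-> -> _] _] := serial_reg_free n r; rewrite !inE.
  by case: a {nB en}.
(* Inside a block, its owner acts at this very slot, which interferes. Any other thread is already
   at the beginning of triple [n.+1]. *)
- have [[c [ec lc tc]]|h] := here n a.
    exists (n * 3).+1, c; rewrite leqnn conc_thr //; split=> //.
    by rewrite /ser_act weaveE /act_order ec; case: c lc {ec tc}.
  have [e1 e2] := away n _ h.
  have ia : idle_act a.
    by apply: menabled_idle_act en _ => r; rewrite /ser_reg weaveE.
  have [en1 _] := en; rewrite /ser_thr weaveE e1 in en1.
  have [|i [b [ni ei cb]]] := @serial_thr_just n.+1 a nB ia.
    by apply: en1; case: a ia {nB en h e1 e2}.
  by exists i, b; split=> //; lia.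
- have [[c [ec lc tc]]|h] := here n a.
    have [b eb tb] : exists2 b, act_finish n = Some b & thr b = thr c.
      by rewrite /act_finish ec; case: c lc {ec tc} => // t r _; eexists.
    exists (n * 3).+2, b; rewrite leqnn conc_thr ?tb //; split=> //.
    by rewrite /ser_act weaveE.
  have [e1 e2] := away n _ h.
  have ia : idle_act a.
    apply: menabled_idle_act en _ => r; rewrite /ser_reg weaveE.
    by rewrite !ordE.
  have [en1 _] := en; rewrite /ser_thr weaveE e1 in en1.
  have [|i [b [ni ei cb]]] := @serial_thr_just n.+1 a nB ia.
    by apply: en1; case: a ia {nB en h e1 e2}.
  by exists i, b; split=> //; lia.
Qed.

End Serialization.

End Model.

Theorem theorem28 (G : signature) (T : tid G -> lts (act G))
    (hT : forall t : tid G, is_thread t (T t)) (C : criterion) :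
  WCT C (model T (variant_register C)) = WCT C (model T (@atomic_register G)).
Proof.
rewrite variant_model; apply: funext => w; apply: propext.
change (@atomic_register G) with
  (fun r => register_lts (@atomic_guard G r) (@atomic_guard G r)).
rewrite -/(gmodel T (@atomic_guard G) (@atomic_guard G)) !(WCT_mrun hT).
split=> -[th [q [ac [hr hj hw]]]].
  exists th, q, ac; split=> //; first exact: variant_run_atomic hr.
  exact: variant_just_atomic hr hj.
eexists; eexists; eexists; split.
- apply: (serial_run hT hr hj) => r s t e1 e2.
  (* Every variant guard holds in a register without readers and writers. *)
  by case: C {hj}; rewrite /variant_rg /variant_wg e1 e2 ?inE ?setU0 !eqxx.
- exact: serial_just.
- exact: serial_collapses.
Qed.
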